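(* Let $T$ be a once punctured torus, let $\rho:\pi_1(T)\to \mathrm{SL}(2,\mathbf{C})$ be an irreducible representation, and let $\mu=\tau+2$, where $\tau\in\mathbf{C}$ is the peripheral trace of $\rho$. Let $p_1,p_2,p_3\in\mathbf{C}$ be arbitrary with $p_1+p_2+p_3=1$. If $\rho$ satisfies the Bowditch conditions, then, writing $x=\mathrm{tr}\,\rho(X)$, $$\sum_{X\in\Omega_1} h_{\mu,p_1}(x)+\sum_{X\in\Omega_2} h_{\mu,p_2}(x)+\sum_{X\in\Omega_3} h_{\mu,p_3}(x)=\frac12,$$ where the three infinite sums converge absolutely, and for $p\in\mathbf{C}$ the function $h_{\mu,p}:\mathbf{C}\setminus([-2,2]\cup\{\pm\sqrt{\mu}\})\to\mathbf{C}$ is defined by $$h_{\mu,p}(x)=\frac12\left(1-\frac{x^2-(1-p)\mu}{x^2-\mu}\sqrt{1-\frac{4}{x^2}}\right).$$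
   Context: $T$ is a once punctured torus; $\pi_1(T)$ is a free group of rank two. Peripheral trace: for a representation $\rho:\pi_1(T)\to\mathrm{SL}(2,\mathbf{C})$, its peripheral trace is $\tau=\mathrm{tr}\,\rho(aba^{-1}b^{-1})$, where $\{a,b\}$ is a free basis of $\pi_1(T)$; it does not depend on the choice of free basis. $\Omega$ is the set of isotopy classes of unoriented essential (i.e. nontrivial and not boundary-parallel) simple closed curves in $T$. An element $X\in\Omega$ corresponds to the union of the conjugacy classes of a pair of mutually inverse elements of $\pi_1(T)$, so $\mathrm{tr}\,\rho(X)\in\mathbf{C}$ is well defined. Tri-coloring: given a free basis $\{a,b\}$ of $\pi_1(T)$, $\Omega$ is identified with $\mathbf{Q}\cup\{1/0\}$ via slopes of $\mathbf{Z}$-homology classes, so that the curves represented by $a$, $b$, $ab$, $ab^{-1}$ have slopes $0/1$, $1/0$, $1/1$, $-1/1$ respectively, and each element of $\Omega$ has a unique slope $s/r$ with $r,s$ coprime integers. Then $\Omega=\Omega_1\sqcup\Omega_2\sqcup\Omega_3$, the three classes consisting respectively of the curves with slope $s/r$ for which only $r$ is odd, only $s$ is odd, and both $r,s$ are odd. Equivalently, the three classes correspond to the three nontrivial $\mathbf{Z}_2$-homology classes of $T$. Bowditch conditions: an irreducible representation $\rho:\pi_1(T)\to\mathrm{SL}(2,\mathbf{C})$ satisfies the Bowditch conditions if (i) $\mathrm{tr}\,\rho(X)\notin[-2,2]\subset\mathbf{R}$ for all $X\in\Omega$, and (ii) the set $\{X\in\Omega: |\mathrm{tr}\,\rho(X)|\le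 2\}$ is finite (possibly empty). (It is known that under these conditions $\mathrm{tr}\,\rho(X)\ne\pm\sqrt{\mu}$ for all $X\in\Omega$, so the terms of the sums are defined.) Convention: the square root function takes values in $\{z\in\mathbf{C}:\Re(z)\ge 0\}$. *)

(* Defs.v *)
From HB Require Import structures.
From mathcomp Require Import all_boot all_order all_algebra.
From mathcomp Require Import finmap complex.
From mathcomp Require Import all_classical all_reals all_analysis.
From mathcomp.analysis.showcase Require summability.
Set Implicit Arguments.
Unset Strict Implicit.
Unset Printing Implicit Defensive.
Import Order.TTheory GRing.Theory Num.Theory.
Import numFieldNormedType.Exports.
Local Open Scope classical_set_scope.
Local Open Scope ring_scope.
Local Open Scope complex_scope.

(* The once punctured torus T enters through its fundamental group [pi1],
   a [groupType] that is free of rank two: it has a free basis [a], [b]. *)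

(* Universal property of the free group on [a], [b]. *)
Definition free_basis (pi1 : groupType) (a b : pi1) : Prop :=
  forall (G : groupType) (x y : G),
    exists! f : pi1 -> G,
      [/\ {morph f : g h / (g * h)%g}, f a = x & f b = y].

Definition primitive (pi1 : groupType) (g : pi1) : Prop :=
  exists h : pi1, free_basis g h.

(* The union of the conjugacy classes of [g] and [g^-1]: the free homotopy
   class of an unoriented closed curve representing [g]. *)
Definition unoriented_class (pi1 : groupType) (g : pi1) : set pi1 :=
  [set x | exists y : pi1, x = (g ^ y)%g \/ x = (g^-1 ^ y)%g].

(* Isotopy classes of unoriented essential simple closed curves in T, each
   given by the subset of [pi1] that it determines; by Dehn and Nielsen, an
   element of [pi1] is represented by such a curve exactly when it belongs to
   a free basis, and the isotopy class is determined by the subset. *)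
Definition Omega (pi1 : groupType) : set (set pi1) :=
  [set X | exists2 g : pi1, primitive g & X = unoriented_class g].

(* [g] = r[a] + s[b] in the first homology of T, i.e. in the abelianization
   of [pi1], expressed by its universal property. *)
Definition homology_coords (pi1 : groupType) (a b g : pi1) (r s : int) : Prop :=
  forall (V : zmodType) (f : pi1 -> V),
    {morph f : x y / (x * y)%g >-> x + y} -> f g = f a *~ r + f b *~ s.

(* The slope is s/r, so [a], [b], [a * b], [a * b^-1] have slopes
   0/1, 1/0, 1/1, -1/1; (r, s) is determined by the curve up to sign. *)
Definition has_slope (pi1 : groupType) (a b : pi1) (X : set pi1) (r s : int) :=
  coprimez r s /\ exists2 g, X g & homology_coords a b g r s.

Definition Omega1 (pi1 : groupType) (a b : pi1) : set (set pi1) :=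
  [set X | Omega X /\
    exists r s : int, [/\ has_slope a b X r s, odd `|r|%N & ~~ odd `|s|%N]].

Definition Omega2 (pi1 : groupType) (a b : pi1) : set (set pi1) :=
  [set X | Omega X /\
    exists r s : int, [/\ has_slope a b X r s, ~~ odd `|r|%N & odd `|s|%N]].

Definition Omega3 (pi1 : groupType) (a b : pi1) : set (set pi1) :=
  [set X | Omega X /\
    exists r s : int, [/\ has_slope a b X r s, odd `|r|%N & odd `|s|%N]].

Definition SL2_representation (R : realType) (pi1 : groupType)
    (rho : pi1 -> 'M[R[i]]_2) : Prop :=
  {morph rho : g h / (g * h)%g >-> g *m h} /\ forall g, \det (rho g) = 1.

(* The subspaces of C^2 are the row spaces of the matrices [U], as in
   [mx_irreducible], which is restricted to finite groups. *)
Definition irreducible_representation (R : realType) (pi1 : groupType)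
    (rho : pi1 -> 'M[R[i]]_2) : Prop :=
  forall U : 'M[R[i]]_2,
    (forall g, stablemx U (rho g)) -> U != 0 -> row_full U.

Definition peripheral_trace (R : realType) (pi1 : groupType) (a b : pi1)
    (rho : pi1 -> 'M[R[i]]_2) : R[i] :=
  \tr (rho (a * b * a^-1 * b^-1)%g).

(* The trace is constant on the classes in [Omega]; [xget 1%g X] is an
   arbitrary element of [X]. *)
Definition curve_trace (R : realType) (pi1 : groupType)
    (rho : pi1 -> 'M[R[i]]_2) (X : set pi1) : R[i] :=
  \tr (rho (xget 1%g X)).

(* In the partial order of R[i], [-2 <= x <= 2] says that x is real and lies
   in the interval [-2, 2]. *)
Definition Bowditch_conditions (R : realType) (pi1 : groupType)
    (rho : pi1 -> 'M[R[i]]_2) : Prop :=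
  (forall X, Omega X -> ~~ (-2 <= curve_trace rho X <= 2)) /\
  finite_set [set X | Omega X /\ `|curve_trace rho X| <= 2].

(* [sqrtc] takes values in the half-plane Re >= 0. The formula is used only
   for x outside [-2, 2] with x ^+ 2 != mu. *)
Definition h_fun (R : realType) (mu p x : R[i]) : R[i] :=
  2^-1 * (1 - (x ^+ 2 - (1 - p) * mu) / (x ^+ 2 - mu)
                * sqrtc (1 - 4 / x ^+ 2)).

Lemma Re_sqrtc_ge0 (R : realType) (z : R[i]) : 0 <= complex.Re (sqrtc z).
Proof. by case: z => x y; rewrite /= sqrtr_ge0. Qed.

(* Unordered summation: [summability.totally] is the filter of the directed
   set of finite subsets of [I]. *)
Definition has_sum (K : numFieldType) (I : choiceType) (D : set I)
    (f : I -> K) (S : K) : Prop :=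
  (fun A : {fset I} => \sum_(i <- A | i \in D) f i)
    @ summability.totally --> S.

Definition has_abs_sum (R : realType) (I : choiceType) (D : set I)
    (f : I -> R[i]) (S : R[i]) : Prop :=
  summable D (fun i => (ComplexField.Normc.normc (f i))%:E) /\ has_sum D f S.

(* Main.v *)
(* Give a curve X with trace x the number k = (1 - sqrt(1 - 4/x^2))/2. When the
   triples (X, Y, Z) of pairwise once-intersecting curves are arranged along the
   Farey tree, their traces solve x^2 + y^2 + z^2 - xyz = mu and a step in the tree
   replaces one entry, e.g. y by xz - y. To the edge {X, Y}, seen from the side of
   Z, attach, with E = (xy - z)/(xy),

     H = (E - k_x - k_y + p_X mu (E - k_x)/(x^2 - mu) + p_Y mu (E - k_y)/(y^2 - mu))/2.

   The relation p_1 + p_2 + p_3 = 1 and the fact that every triangle contains one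
   curve of each colour make H(X, Y) - H(X, Z) - H(Z, Y) equal to h(z), and the two
   values of H on the two sides of one edge add up with h(x) + h(y) to 1/2. So the
   partial sums of h over balls of the tree equal 1/2 up to a sum of H over a
   sphere, and everything follows from H = O(1/|xy|), h(z) = O(1/|z|) and the
   convergence of the sum of 1/|z| + 1/|xy| over the tree.

   For the latter: in a branch where |x|, |y| > 2 and |xy| <= 2|z| the numbers
   |x|/2 grow at least multiplicatively, which gives an explicit bound. If the sum
   diverged there would be a path all of whose branches are divergent. A path that
   finally turns around a single curve X is excluded since the neighbours of X grow
   geometrically. Any other path has decreasing traces whose moduli must tend to 2,
   and this forces mu = 4, which contradicts irreducibility.

   That the tree enumerates all curves, each once, is Nielsen's theorem: a basis of
   the free group which cannot be shortened by Nielsen moves and conjugation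
   consists of letters. *)

(* One factorization carries the analysis. Let l = x k_x, the root of modulus below 1 of t^2 - x t +
   1. Then the Markoff equation reads (xy - z - l y)(z - l y) = x^2 - mu. It serves three ends. If
   x^2 = mu, one factor vanishes and the traces around X decay geometrically in one direction,
   against the finiteness of the set of small traces; so all denominators are nonzero. It gives E -
   k_x = (x^2 - mu)/(xy (z - l y)), so the denominators x^2 - mu, which are not bounded below a
   priori, cancel in the mu-terms of H. Finally it reduces the estimate of H to a lower bound for |z
   - l y|, which follows from |y| <= |z| and a uniform gap 1 - |l|; the gap is uniform because
   summability of 1/|z| leaves only finitely many traces of modulus at most 3.

   The group is given by a universal property alone. Each fact about it therefore comes from a
   homomorphism into a suitable group: a subgroup for induction, the bijections of the set of
   reduced words for normal forms, the integers for slopes. *)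
Require Import Defs.
From HB Require Import structures.
From mathcomp Require Import all_boot all_order all_algebra.
From mathcomp Require Import finmap complex.
From mathcomp Require Import all_classical all_reals all_analysis.
From mathcomp Require Import zify ring lra.
Set Implicit Arguments.
Unset Strict Implicit.
Unset Printing Implicit Defensive.
Import Order.TTheory GRing.Theory Num.Theory.
Import numFieldNormedType.Exports.
Local Open Scope classical_set_scope.
Local Open Scope ring_scope.
Local Open Scope complex_scope.

(** * Free groups and reduced words *)

Section SubgroupType.
Variables (F : groupType) (P : F -> Prop).
Hypotheses (P1 : P 1%g) (PM : forall x y, P x -> P y -> P (x * y)%g)
  (PV : forall x, P x -> P x^-1%g).

Definition in_subgroup : {pred F} := [pred x | `[< P x >]].

(** The closure proofs are parameters, so that the group structure is attached to the type once for
    all predicates. *)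
Definition subgroup_type of P 1%g & (forall x y, P x -> P y -> P (x * y)%g)
  & (forall x, P x -> P x^-1%g) := {x : F | in_subgroup x}.

Local Notation T := (subgroup_type P1 PM PV).

HB.instance Definition _ := [isSub of T for @sval _ _].
HB.instance Definition _ := [Choice of T by <:].

Fact in_subgroup_closed : group_closed in_subgroup.
Proof.
split; first exact/asboolP.
by move=> x y /asboolP Px /asboolP Py; apply/asboolP/PM => //; exact: PV.
Qed.

HB.instance Definition _ := SubChoice_isSubGroup.Build F in_subgroup T
  in_subgroup_closed.

End SubgroupType.

(** The universal property maps the whole group into the subgroup cut out by [P]; followed by the
    inclusion this fixes [a] and [b], hence is the identity by uniqueness. *)
Lemma free_basis_ind (F : groupType) (a b : F) (P : F -> Prop) :
  free_basis a b -> P a -> P b -> P 1%g ->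
  (forall x y, P x -> P y -> P (x * y)%g) -> (forall x, P x -> P x^-1%g) ->
  forall x, P x.
Proof.
move=> hab Pa Pb P1 PM PV x.
have Pa' : a \in in_subgroup P by apply/asboolP.
have Pb' : b \in in_subgroup P by apply/asboolP.
pose T := subgroup_type P1 PM PV.
have [f [[fM fa fb] _]] := hab T (Sub a Pa') (Sub b Pb').
have [g [_ gU]] := hab F a b.
have <- : val (f x) = x.
  have -> : val (f x) = g x.
    rewrite (gU (fun x => val (f x))) //; split; rewrite ?fa ?fb ?SubK //.
    by move=> y z; rewrite fM valM.
  by rewrite (gU id).
exact/asboolP/(valP (f x)).
Qed.

Section SymmetricGroup.
Variable T : Type.

Record bijection := Bijection {
  bij_fun : T -> T; bij_inv : T -> T;
  bij_funK : cancel bij_fun bij_inv; bij_invK : cancel bij_inv bij_fun }.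

Lemma bijection_ext (f g : bijection) : bij_fun f =1 bij_fun g -> f = g.
Proof.
case: f g => f f' fK f'K [g g' gK g'K] /= /funext fg; subst g.
have fg' : f' = g' by apply: funext => x; rewrite -{1}(g'K x) fK.
subst g'.
by rewrite (Prop_irrelevance fK gK) (Prop_irrelevance f'K g'K).
Qed.

HB.instance Definition _ := gen_eqMixin bijection.
HB.instance Definition _ := gen_choiceMixin bijection.

Definition bij_one := @Bijection id id (frefl _) (frefl _).
Definition bij_swap f := Bijection (bij_invK f) (bij_funK f).
Definition bij_mul f g := Bijection
  (can_comp (bij_funK f) (bij_funK g)) (can_comp (bij_invK g) (bij_invK f)).

Fact bij_mulA : associative bij_mul.
Proof. by move=> f g h; exact: bijection_ext. Qed.
Fact bij_mul1 : left_id bij_one bij_mul.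
Proof. by move=> f; exact: bijection_ext. Qed.
Fact bij_1mul : right_id bij_one bij_mul.
Proof. by move=> f; exact: bijection_ext. Qed.
Fact bij_mulV : left_inverse bij_one bij_swap bij_mul.
Proof. by move=> f; apply: bijection_ext => x /=; exact: bij_funK. Qed.
Fact bij_Vmul : right_inverse bij_one bij_swap bij_mul.
Proof. by move=> f; apply: bijection_ext => x /=; exact: bij_invK. Qed.

HB.instance Definition _ := isGroup.Build bijection
  bij_mulA bij_mul1 bij_1mul bij_mulV bij_Vmul.

End SymmetricGroup.

Section MultiplicativeGroup.
Variable V : zmodType.

(** The universal property quantifies over multiplicative groups; this wrapper lets it produce
    homomorphisms into the integers. *)
Definition mul_of_zmod := V.
HB.instance Definition _ := Choice.on mul_of_zmod.
HB.instance Definition _ := isGroup.Build mul_of_zmod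
  (@addrA V) (@add0r V) (@addr0 V) (@addNr V) (@addrN V).

End MultiplicativeGroup.

(* A letter (i, e) stands for the generator a (i = false) or b (i = true),
   inverted when e is true. *)
Definition letter := (bool * bool)%type.
Definition linv (x : letter) : letter := (x.1, ~~ x.2).
Definition reduced : pred (seq letter) := sorted (fun x y => y != linv x).
Definition winv (s : seq letter) := rev (map linv s).
Definition push (x : letter) (s : seq letter) :=
  if s is y :: s' then if y == linv x then s' else x :: s else [:: x].

Lemma linvK : involutive linv.
Proof. by case=> i e; rewrite /linv /= negbK. Qed.

Lemma linv_neq x : linv x != x.
Proof. by case: x => -[] []. Qed.

Lemma push_reduced x s : reduced s -> reduced (push x s).
Proof.
case: s => //= y s; case: ifP => [_|yx]; first by case: s => //= z s /andP[].
by rewrite /reduced /= yx.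
Qed.

Lemma pushK x s : reduced s -> push (linv x) (push x s) = s.
Proof.
case: s => [|y s] /=; first by rewrite linvK eqxx.
case: eqP => [->|yx] rs; last by rewrite /= linvK eqxx.
by case: s rs => //= z s; rewrite linvK => /andP[/negPf->].
Qed.

Definition rword := {s : seq letter | reduced s}.

Definition rpush x (s : rword) : rword :=
  exist (fun s => is_true (reduced s)) _ (push_reduced x (svalP s)).

Lemma rpushK x : cancel (rpush x) (rpush (linv x)).
Proof. by move=> s; apply: val_inj; rewrite /= pushK ?(svalP s). Qed.

Lemma rpushVK x : cancel (rpush (linv x)) (rpush x).
Proof. by move=> s; rewrite -{1}(linvK x) rpushK. Qed.

Definition push_bij x := Bijection (rpushK x) (rpushVK x).

Lemma push_bijV x : push_bij (linv x) = (push_bij x)^-1%g.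
Proof. exact: bijection_ext. Qed.

Lemma reduced_winv s : reduced s -> reduced (winv s).
Proof.
rewrite /reduced /winv rev_sorted sorted_map; apply: sub_sorted => x y /=.
by rewrite /relpre /= linvK eq_sym.
Qed.

Lemma reduced_rcons_cat s x t y : reduced (rcons s x) -> reduced (y :: t) ->
  y != linv x -> reduced (rcons s x ++ y :: t).
Proof.
rewrite /reduced; case: s => [|z s] /=; first by move=> _ -> ->.
by move=> h1 h2 h3; rewrite cat_path h1 last_rcons /= h3.
Qed.

Fixpoint lcp (s t : seq letter) : nat :=
  if (s, t) is (x :: s', y :: t') then if x == y then (lcp s' t').+1 else 0%N
  else 0%N.

Lemma lcpC s t : lcp s t = lcp t s.
Proof.
elim: s t => [|x s IH] [|y t] //=; rewrite eq_sym; case: ifP => // _.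
by rewrite IH.
Qed.

(** Words under the prefix order form a tree; the comparisons of cancellations in Nielsen's theorem
    rest on this ultrametric inequality. *)
Lemma lcp_ultra s t u : (minn (lcp s t) (lcp t u) <= lcp s u)%N.
Proof.
elim: s t u => [|x s IH] [|y t] [|z u] //=; rewrite ?minn0 ?min0n //.
case: eqP => [->|_]; last by rewrite min0n.
by case: eqP => // _; rewrite ?minn0 // minnSS ltnS IH.
Qed.

Lemma lcp_size s t : (lcp s t <= size s)%N.
Proof. by elim: s t => [|x s IH] [|y t] //=; case: eqP => //; rewrite ltnS IH. Qed.

Lemma lcp_take k s : (k <= size s)%N -> lcp (take k s) s = k.
Proof. by elim: s k => [|x s IH] [|k] //= /IH; rewrite eqxx => ->. Qed.

Lemma lcp_takeE s t : take (lcp s t) s = take (lcp s t) t.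
Proof.
by elim: s t => [|x s IH] [|y t] //=; case: eqP => //= ->; rewrite IH.
Qed.

(** An overlap of half the length would make letters of [s] inverse to their mirror images up to the
    middle. In odd length the middle letter would be its own inverse, in even length the two middle
    letters would cancel. *)
Lemma lcp_winv (s : seq letter) : reduced s -> s != [::] ->
  (2 * lcp (winv s) s < size s)%N.
Proof.
move=> rs s0; rewrite ltnNge; apply/negP => hk.
set k := lcp _ _ in hk; pose n := size s.
have n0 : (0 < n)%N by rewrite /n lt0n size_eq0.
have sw : size (winv s) = n by rewrite /winv size_rev size_map.
have key i : (i < k)%N -> nth (false, false) s i = linv (nth (false, false) s (n - i.+1)).
  move=> ik; have lt_in : (i < n)%N.
    by apply: leq_trans ik _; rewrite -sw; exact: lcp_size.
  rewrite -(nth_take _ ik) -lcp_takeE nth_take //.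
  rewrite /winv nth_rev ?size_map // (nth_map (false, false)) //.
  by rewrite -/n; lia.
have [on|en] := boolP (odd n).
  have := key n./2 ltac:(move: hk; rewrite -/n; lia).
  have -> : (n - n./2.+1 = n./2)%N by lia.
  by move/esym/eqP; apply/negP; exact: linv_neq.
have := key n./2.-1 ltac:(move: hk; rewrite -/n; lia).
have -> : (n - n./2.-1.+1 = n./2.-1.+1)%N by lia.
have := rs; rewrite /reduced => /(sortedP (false, false)) /(_ n./2.-1).
move=> /(_ ltac:(rewrite -/n; lia)) /eqP h1 h2; apply: h1.
by rewrite h2 linvK.
Qed.

(** * Normal forms and cancellation in a free group of rank two *)

Section FreeGroup.
Variables (F : groupType).
Local Open Scope group_scope.

Definition leval (g h : F) (x : letter) : F :=
  let c := if x.1 then h else g in if x.2 then c^-1 else c.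
Definition weval (g h : F) (s : seq letter) : F :=
  foldr (fun x c => leval g h x * c) 1 s.

Lemma levalV g h x : leval g h (linv x) = (leval g h x)^-1.
Proof. by case: x => -[] [] //=; rewrite /leval /= invgK. Qed.

Lemma weval_cat g h s t : weval g h (s ++ t) = weval g h s * weval g h t.
Proof. by elim: s => [|x s IH] /=; rewrite ?mul1g // IH mulgA. Qed.

Lemma wevalV g h s : weval g h (winv s) = (weval g h s)^-1.
Proof.
elim: s => [|x s IH] /=; first by rewrite invg1.
rewrite /winv /= rev_cons -cats1 weval_cat -/(winv s) IH /= levalV mulg1.
by rewrite invgM.
Qed.

Lemma weval_push g h x s : weval g h (push x s) = leval g h x * weval g h s.
Proof.
case: s => [|y s] //=; case: eqP => //= ->.
by rewrite levalV mulVKg.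
Qed.

Lemma morph_one (G H : groupType) (f : G -> H) :
  {morph f : x y / x * y} -> f 1 = 1.
Proof. by move=> fM; apply: (mulgI (f 1)); rewrite -fM !mulg1. Qed.

Lemma morph_inv (G H : groupType) (f : G -> H) :
  {morph f : x y / x * y} -> {morph f : x / x^-1}.
Proof.
by move=> fM x; apply: (mulgI (f x)); rewrite -fM !mulgV morph_one.
Qed.

Variables (a b : F).
Hypothesis hab : free_basis a b.

(* The free group acts on reduced words by left multiplication; the normal form
   of g is the image of the empty word. *)
Definition word_action : F -> bijection rword :=
  xget (fun=> 1) [set f : F -> bijection rword | [/\ {morph f : x y / x * y},
    f a = push_bij (false, false) & f b = push_bij (true, false)]].

Lemma word_actionP : [/\ {morph word_action : x y / x * y},
  word_action a = push_bij (false, false) & word_action b = push_bij (true, false)].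
Proof.
have [f [fP _]] := hab (push_bij (false, false)) (push_bij (true, false)).
by rewrite /word_action; case: xgetP => [g _ //|/(_ f)].
Qed.

Definition rnil : rword := exist (fun s => is_true (reduced s)) [::] isT.
Definition nf (g : F) : seq letter := sval (bij_fun (word_action g) rnil).

Lemma nf_reduced g : reduced (nf g).
Proof. exact: (svalP (bij_fun (word_action g) rnil)). Qed.

Lemma word_action_weval (g : F) (s : rword) :
  weval a b (sval (bij_fun (word_action g) s)) = g * weval a b (sval s).
Proof.
have [fM fa fb] := word_actionP.
pose P g := forall s : rword,
  weval a b (sval (bij_fun (word_action g) s)) = g * weval a b (sval s).
suff: P g by exact.
move: g {s}; refine (@free_basis_ind F a b P hab _ _ _ _ _); rewrite /P.
- by move=> s; rewrite fa /= weval_push.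
- by move=> s; rewrite fb /= weval_push.
- by move=> s; rewrite (morph_one fM) /= mul1g.
- by move=> x y IHx IHy s; rewrite fM /= IHx IHy mulgA.
- by move=> x IH s; rewrite (morph_inv fM) /= -[in RHS](bij_invK (word_action x) s) IH mulKg.
Qed.

Lemma nfK : cancel nf (weval a b).
Proof. by move=> g; rewrite word_action_weval /= mulg1. Qed.

Lemma nf_weval s : reduced s -> nf (weval a b s) = s.
Proof.
have [fM fa fb] := word_actionP.
have fx x : word_action (leval a b x) = push_bij x.
  by case: x => -[] []; rewrite /leval /= ?(morph_inv fM) ?fa ?fb -?push_bijV.
elim: s => [|x s IH] rs /=; first by rewrite /nf (morph_one fM).
rewrite /nf fM /= fx /= -/(nf _) IH; last by case: s rs {IH} => //= y s /andP[].
by case: s rs {IH} => //= y s /andP[/negPf->].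
Qed.

Lemma nf_inj : injective nf. Proof. exact: can_inj nfK. Qed.

Lemma nf1 : nf 1 = [::]. Proof. exact: (@nf_weval [::]). Qed.

Lemma nfV g : nf g^-1 = winv (nf g).
Proof. by rewrite -{1}(nfK g) -wevalV nf_weval // reduced_winv ?nf_reduced. Qed.

Definition len g := size (nf g).
Definition ovl g h := lcp (nf g) (nf h).

Lemma ovlC g h : ovl g h = ovl h g. Proof. exact: lcpC. Qed.

Lemma ovl_ultra g h k : (minn (ovl g h) (ovl h k) <= ovl g k)%N.
Proof. exact: lcp_ultra. Qed.

Lemma ovl_len g h : (ovl g h <= len g)%N. Proof. exact: lcp_size. Qed.

Lemma lenV g : len g^-1 = len g.
Proof. by rewrite /len nfV size_rev size_map. Qed.

Lemma len_eq0 g : (len g == 0)%N = (g == 1).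
Proof. by rewrite /len size_eq0 -nf1 (inj_eq nf_inj). Qed.

Lemma ovl_sqr g : g != 1 -> (2 * ovl g^-1 g < len g)%N.
Proof.
rewrite -len_eq0 /len size_eq0 /ovl nfV => g0.
by apply: lcp_winv => //; exact: nf_reduced.
Qed.

(** Past the common prefix the two words start with different letters, so inverting one and
    appending the other yields a reduced word: exactly the overlap cancels. *)
Lemma len_mulVg g h : (len (g^-1 * h) + 2 * ovl g h = len g + len h)%N.
Proof.
rewrite /len /ovl; have [rg rh] := (nf_reduced g, nf_reduced h).
rewrite -{1}(nfK g) -{1}(nfK h).
elim: (nf g) (nf h) rg rh => [|x s IH] t rs rt.
  by rewrite /= invg1 mul1g nf_weval //; lia.
case: t rt => [|y t] rt.
  rewrite [weval _ _ [::]]/= mulg1 -wevalV nf_weval ?reduced_winv //.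
  by rewrite /winv size_rev size_map /=; lia.
have wc z u : weval a b (z :: u) = leval a b z * weval a b u by [].
rewrite [lcp _ _]/=; case: eqP => [<-|/eqP xy].
  rewrite !wc invgM -mulgA mulKg [size (x :: s)]/= [size (x :: t)]/=.
  have rs' : reduced s by case: (s) rs => //= z ? /andP[].
  have rt' : reduced t by case: (t) rt => //= z ? /andP[].
  by rewrite mulnS addnCA (IH t rs' rt') addSn addnS.
rewrite -(wevalV _ _ (x :: s)) -(weval_cat _ _ _ (y :: t)) nf_weval.
  by rewrite size_cat /winv size_rev size_map /=; lia.
have := reduced_winv rs; rewrite /winv /= rev_cons => rw.
by apply: reduced_rcons_cat => //; rewrite linvK eq_sym.
Qed.

End FreeGroup.

(** * Pairs of generators and the Farey tree *)

Ltac grp := rewrite ?conjgE ?(invgM, invgK, invg1);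
  rewrite ?(mulgA, mulgK, mulgVK, mulgV, mulVg, mulg1, mul1g).

Section BasisMoves.
Variable F : groupType.
Implicit Types g h t : F.
Local Open Scope group_scope.

Lemma free_basis_swap g h : free_basis g h -> free_basis h g.
Proof.
move=> gh G x y; have [f [[fM fg fh] fU]] := gh G y x.
by exists f; split=> // f' [f'M f'h f'g]; apply: fU.
Qed.

Lemma free_basisV g h : free_basis g h -> free_basis g^-1 h.
Proof.
move=> gh G x y; have [f [[fM fg fh] fU]] := gh G x^-1 y.
exists f; split; first by split=> //; rewrite (morph_inv fM) fg invgK.
by move=> f' [f'M f'g f'h]; apply: fU; split=> //; rewrite -f'g (morph_inv f'M) invgK.
Qed.

Lemma free_basisM g h : free_basis g h -> free_basis g (g * h).
Proof.
move=> gh G x y; have [f [[fM fg fh] fU]] := gh G x (x^-1 * y).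
exists f; split; first by split=> //; rewrite fM fg fh mulVKg.
by move=> f' [f'M f'g f'h]; apply: fU; split=> //; rewrite -f'h f'M f'g mulKg.
Qed.

Lemma free_basisJ g h t : free_basis g h -> free_basis (g ^ t) (h ^ t).
Proof.
move=> gh G x y; have [f [[fM fg fh] fU]] := gh G x y.
exists (fun s => f (s ^ t^-1)); split.
  by split; rewrite ?conjgK // => u v; rewrite conjMg fM.
move=> f' [f'M f'g f'h]; rewrite (fU (fun s => f' (s ^ t))).
  by apply/funext => s; rewrite conjgKV.
by split=> // u v; rewrite conjMg f'M.
Qed.

Lemma free_basisMr g h : free_basis g h -> free_basis (g * h) h.
Proof.
move=> gh; apply: free_basis_swap; rewrite -(invgK (g * h)) invgM.
rewrite -{1}(invgK h); apply/free_basis_swap/free_basisV/free_basis_swap.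
by apply/free_basisV/free_basisM/free_basisV/free_basis_swap/free_basisV.
Qed.

Lemma free_basis_neq1 g h : free_basis g h -> g != 1.
Proof.
move=> gh; apply/eqP => g1; have [f [[fM fg _] _]] := gh (mul_of_zmod int) 1%R 0%R.
by have := morph_one fM; rewrite -g1 fg.
Qed.

Lemma free_basis_letters g h x y : x.1 != y.1 -> free_basis g h ->
  free_basis (leval g h x) (leval g h y).
Proof.
move=> xy gh.
have key (p q : F) (e f : bool) : free_basis p q ->
    free_basis (if e then p^-1 else p) (if f then q^-1 else q).
  move=> pq; case: e; [apply: free_basisV|]; case: f => //;
  by apply/free_basis_swap/free_basisV/free_basis_swap.
case: x y xy => [[] e] [[] f] //= _; rewrite /leval /=; apply: key => //.
exact: free_basis_swap.
Qed.

Lemma free_basis_words g h x : free_basis g h ->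
  exists2 s, reduced s & x = weval g h s.
Proof.
move=> gh; pose P x := exists2 s, reduced s & x = weval g h s.
have Px z : P (leval g h z) by exists [:: z] => //=; rewrite mulg1.
refine (@free_basis_ind F g h P gh (Px (false, false)) (Px (true, false)) _ _ _ x).
- by exists [::].
- move=> _ v [s rs ->] Pv; elim: s rs => [|z s IH] rs; first by rewrite mul1g.
  have [|t rt /= E] := IH; first by case: (s) rs => //= ? ? /andP[].
  exists (push z t); first exact: push_reduced.
  by rewrite weval_push -E -mulgA.
- by move=> _ [s rs ->]; exists (winv s); rewrite ?reduced_winv ?wevalV.
Qed.

(** The curves g, h, gh span a triangle of the Farey tessellation. The values true and false of [c]
    cross its sides {gh, h} and {g, gh}, and the product of the new pair is the new third curve. *)
Definition gstep (p : F * F) (c : bool) :=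
  if c then (p.1 * p.2, p.2) else (p.1, p.1 * p.2).

Definition eqV g h := g = h \/ g = h^-1.

(** Curves are unoriented, so each entry may be inverted separately; the conjugator is shared, since
    otherwise products of the two entries would not correspond. *)
Definition sim g h (p : F * F) := exists t, eqV (g ^ t) p.1 /\ eqV (h ^ t) p.2.

Variables a b : F.

(* The vertices of the Farey tree on either side of the edge {a, b}: the pair
   (g, h) at the word w stands for the vertex of the three curves g, h, gh. *)
Definition groot (e : bool) : F * F := (if e then a^-1 else a, b).
Definition gnode (e : bool) (w : seq bool) : F * F := foldl gstep (groot e) w.

Definition farey_pair g h :=
  exists e w, sim g h (gnode e w) \/ sim h g (gnode e w).

Lemma eqVV g h : eqV g h -> eqV g^-1 h.
Proof. by case=> ->; [right|left; rewrite invgK]. Qed.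

Lemma farey_swap g h : farey_pair g h -> farey_pair h g.
Proof. by move=> [e [w [H|H]]]; exists e, w; [right|left]. Qed.

Lemma farey_V g h : farey_pair g h -> farey_pair g^-1 h.
Proof.
move=> [e [w [[t [H1 H2]]|[t [H1 H2]]]]]; exists e, w; [left|right];
  by exists t; rewrite conjVg; split=> //; apply: eqVV.
Qed.

Lemma farey_VE g h : farey_pair g^-1 h <-> farey_pair g h.
Proof. by split=> /farey_V //; rewrite invgK. Qed.

Lemma farey_EV g h : farey_pair g h^-1 <-> farey_pair g h.
Proof. by split=> /farey_swap/farey_VE/farey_swap. Qed.

Lemma farey_J g h t : farey_pair (g ^ t) (h ^ t) <-> farey_pair g h.
Proof.
have key u x y : farey_pair x y -> farey_pair (x ^ u) (y ^ u).
  move=> [e [w [[s H]|[s H]]]]; exists e, w; [left|right];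
  by exists (u^-1 * s); rewrite -!conjgM mulVKg.
by split=> [/(key t^-1)|/key//]; rewrite !conjgK.
Qed.

Lemma farey_node e w : farey_pair (gnode e w).1 (gnode e w).2.
Proof. by exists e, w; left; exists 1; rewrite !conjg1; split; left. Qed.

Lemma farey_node_step e w c :
  farey_pair (gstep (gnode e w) c).1 (gstep (gnode e w) c).2.
Proof. by have := farey_node e (rcons w c); rewrite /gnode foldl_rcons. Qed.

(** Crossing the root edge backwards enters the tree with the opposite value of [e], whose root
    differs by the inversion of [a]; conjugation by [b] matches the second pair. *)
Lemma farey_root_back (e : bool) : let p := groot e in
  farey_pair p.1 (p.1^-1 * p.2) /\ farey_pair (p.1 * p.2^-1) p.2.
Proof.
have := farey_node_step (~~ e) [::] false; have := farey_node_step (~~ e) [::] true.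
rewrite /gnode /=; set x := (if ~~ e then _ else _); set y := (if e then _ else _).
have -> : x = y^-1 by rewrite /x /y; case: (e); rewrite ?invgK.
move=> h1 /farey_VE h2; split=> //.
apply/farey_VE/(farey_J _ _ b).
have -> : (y * b^-1)^-1 ^ b = y^-1 * b by grp.
by have -> : b ^ b = b by grp.
Qed.

(** Below the root the two pairs are the remaining sides of the parent's triangle, up to conjugation
    and inversion: the parent's own pair and the sibling of the node. *)
Lemma farey_node_back e w : let p := gnode e w in
  farey_pair p.1 (p.1^-1 * p.2) /\ farey_pair (p.1 * p.2^-1) p.2.
Proof.
case/lastP: w => [|w c]; first exact: farey_root_back.
rewrite /gnode foldl_rcons -/(gnode e w) /=; set p := gnode e w.
have hN := farey_node e w; have hL := farey_node_step e w false.
have hR := farey_node_step e w true; rewrite -/p /= in hN hL hR.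
case: c => /=.
  split; last by rewrite mulgK.
  apply/(farey_J _ _ p.2^-1)/(farey_J _ _ p.1^-1)/farey_swap/farey_VE.
  have -> : ((((p.1 * p.2)^-1 * p.2) ^ p.2^-1) ^ p.1^-1)^-1 = p.1.
    by grp.
  have -> : ((p.1 * p.2) ^ p.2^-1) ^ p.1^-1 = p.1 * p.2 by grp.
  by [].
split; first by rewrite mulKg.
apply/(farey_J _ _ p.1)/(farey_J _ _ p.2)/farey_swap/farey_EV.
have -> : (((p.1 * (p.1 * p.2)^-1) ^ p.1) ^ p.2)^-1 = p.2 by grp.
have -> : ((p.1 * p.2) ^ p.1) ^ p.2 = p.1 * p.2 by grp.
by [].
Qed.

End BasisMoves.

(** * Nielsen's theorem in rank two *)

Section FareyClosure.
Variables (F : groupType) (a b : F).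
Implicit Types g h : F.
Local Open Scope group_scope.
Local Notation farey := (farey_pair a b).

Lemma farey_MVC g h : farey g (g * h^-1) <-> farey g (g^-1 * h).
Proof.
have <- : (g * h^-1)^-1 ^ g = g^-1 * h by grp.
have {3}<- : g ^ g = g by grp.
by rewrite farey_J farey_EV.
Qed.

Lemma farey_MC g h : farey g (h * g) <-> farey g (g * h).
Proof.
have <- : (g * h) ^ g = h * g by grp.
have {1}<- : g ^ g = g by grp.
by rewrite farey_J.
Qed.

Lemma farey_eqV g h u v : farey g (g * h) -> farey g (g^-1 * h) ->
  eqV u g -> eqV v h -> farey u (u * v).
Proof.
move=> gh gVh [] -> [] ->.
- by [].
- by apply/farey_MVC.
- by apply/farey_VE.
- apply/farey_VE/farey_EV.
  have -> : (g^-1 * h^-1)^-1 = h * g by grp.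
  exact/farey_MC.
Qed.

(** An edge lies in two triangles, with third curves gh and g^-1 h, whose sides come from
    [farey_node_step] and [farey_node_back]. Closure under Nielsen moves lets a shortened basis be
    expanded again. *)
Lemma farey_M g h : farey g h -> farey g (g * h).
Proof.
move=> [e [w [[t [gu hv]]|[t [hu gv]]]]]; apply/(farey_J _ _ _ _ t);
  rewrite conjMg; have [back1 back2] := farey_node_back a b e w;
  have hL := farey_node_step a b e w false;
  have hR := farey_node_step a b e w true; rewrite /= in hL hR.
- exact: farey_eqV gu hv.
- apply: farey_eqV gv hu.
  + exact/farey_MC/farey_swap.
  + apply/farey_MVC/farey_EV.
    rewrite invgM invgK; exact: farey_swap.
Qed.

Lemma farey_letters g h x y : x.1 != y.1 ->
  farey (leval g h x) (leval g h y) -> farey g h.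
Proof.
case: x y => [[] e] [[] f] //= _; rewrite /leval /=; last first.
  by case: e; case: f; rewrite ?farey_VE ?farey_EV.
move=> H; apply: farey_swap; move: H.
by case: e; case: f; rewrite ?farey_VE ?farey_EV.
Qed.

End FareyClosure.

Section Nielsen.
Variables (F : groupType) (a b : F).
Hypothesis hab : free_basis a b.
Local Open Scope group_scope.
Local Notation farey := (farey_pair a b).
Local Notation ln := (len a b).
Local Notation ov := (ovl a b).

Lemma prefix_exists g k : (k <= ln g)%N -> exists q, ln q = k /\ ov q g = k.
Proof.
move=> kg; have rt : reduced (take k (nf a b g)).
  have := nf_reduced a b g; rewrite /reduced. exact: take_sorted.
exists (weval a b (take k (nf a b g))).
rewrite /len /ovl nf_weval // lcp_take // size_takel //.
Qed.

Lemma ov_self g : ov g g = ln g.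
Proof. by rewrite /ovl -{1}(take_size (nf a b g)) lcp_take. Qed.

Lemma len_mul g h : (ln (g * h) + 2 * ov g^-1 h = ln g + ln h)%N.
Proof. by have := len_mulVg hab g^-1 h; rewrite invgK lenV. Qed.

Section ReducedPair.
Variables (g h : F).
Local Notation ev := (leval g h).
Hypothesis N0 : forall x, (0 < ln (ev x))%N.
Hypothesis N1 : forall x y, y != linv x ->
  (2 * ov (ev x)^-1 (ev y) <= ln (ev x))%N /\ (2 * ov (ev x)^-1 (ev y) <= ln (ev y))%N.
Hypothesis N2 : forall x y z, y != linv x -> z != linv y ->
  (ov (ev x)^-1 (ev y) + ov (ev y)^-1 (ev z) < ln (ev y))%N.

Lemma nielsen_reduced_len s x : reduced (x :: s) ->
  let c := if s is y :: _ then ov (ev x)^-1 (ev y) else 0%N in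
  (ln (ev x) <= ov (weval g h (x :: s)) (ev x) + c)%N /\
  (ln (ev x) + size s <= ln (weval g h (x :: s)) + c)%N.
Proof.
elim: s x => [|y s IH] x.
  by rewrite /= mulg1 ov_self !addn0.
rewrite /reduced /= -/(reduced (y :: s)) => /andP[yx rs].
have [] := IH y rs; set w := weval g h (y :: s).
have -> : ev y * weval g h s = w by [].
set c' := (if s is _ :: _ then _ else _) => IH1 IH2.
set c := ov (ev x)^-1 (ev y).
have [c1 c2] := N1 yx; rewrite -/c in c1 c2.
have y0 := N0 y.
have cc : (c + c' < ln (ev y))%N.
  rewrite /c'; case: (s) rs => [|z s'] rs; first by lia.
  by apply: N2 => //; move: rs; rewrite /reduced /= => /andP[].
(* The product [w] agrees with [ev y] on more than [c] letters, so [ev x] cancels against [w] just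
   as it does against [ev y]. *)
have u1 := ovl_ultra a b (ev x)^-1 (ev y) w.
have u2 := ovl_ultra a b (ev x)^-1 w (ev y).
rewrite -/c in u1 u2; rewrite (ovlC _ _ (ev y)) in u1.
have E : ov (ev x)^-1 w = c by lia.
have L1 := len_mul (ev x) w; rewrite E in L1.
have L2 := len_mulVg hab (ev x) (ev x * w); rewrite mulKg in L2.
rewrite (ovlC _ _ (ev x * w)).
by split; lia.
Qed.

(** A word of two or more factors has length above one: the first factor keeps at least half of
    itself and each other factor contributes at least one. *)
Lemma nielsen_reduced_letter c : ln c = 1%N -> free_basis g h -> exists x, c = ev x.
Proof.
move=> c1 gh; have [[|x s] rs cE] := free_basis_words c gh.
  by move: c1; rewrite cE /len nf1.
exists x; case: s rs cE => [|y s] rs cE; first by rewrite cE /= mulg1.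
have := (nielsen_reduced_len rs).2; rewrite -cE c1 /=.
have := N0 x; have [] := N1 (x := x) (y := y); last by lia.
by move: rs; rewrite /reduced /= => /andP[].
Qed.

End ReducedPair.

Lemma nf_gen : (nf a b a = [:: (false, false)]) * (nf a b b = [:: (true, false)]).
Proof.
have E x : nf a b (leval a b x) = [:: x].
  by rewrite -(nf_weval hab (s := [:: x])) //= mulg1.
by split; [rewrite -(E (false, false))|rewrite -(E (true, false))].
Qed.

Lemma farey_ab : farey a b.
Proof. exact: (farey_node a b false [::]). Qed.

(* If exactly half of G cancels on either side against H, then with q the prefix
   of H that cancels, G = p q^-1 and H = q m p^-1, so (HG)^q = m is short. *)
Lemma ovl_half G H : free_basis G H ->
  (ln G <= 2 * ov H^-1 G)%N -> (ln G <= 2 * ov G^-1 H)%N ->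
  (2 * ov H^-1 G <= ln G)%N -> (2 * ov H^-1 G <= ln H)%N ->
  (2 * ov G^-1 H <= ln G)%N ->
  exists q, (ln (G ^ q) + ln ((H * G) ^ q) <= ln H)%N.
Proof.
move=> GH l1 l2 l3 l4 l5; set k := ov G^-1 H in l2 l5.
have kE : ov H^-1 G = k by lia.
rewrite kE in l1 l3 l4.
have [q [qk qH]] := @prefix_exists H k ltac:(lia).
exists q.
have qG : ov q G^-1 = k.
  have := ovl_ultra a b q H G^-1; rewrite qH (ovlC _ _ H) -/k.
  by have := ovl_len a b q G^-1; lia.
pose p := G * q.
have L1 : ln p = k by have := len_mul G q; rewrite (ovlC _ _ G^-1) qG qk -/p; lia.
have pG : ov G p = k.
  by have := len_mulVg hab G p; rewrite /p mulKg -/p; lia.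
have pH : ov p H^-1 = k.
  have := ovl_ultra a b p G H^-1; rewrite (ovlC _ _ p) pG (ovlC _ _ G) kE.
  by have := ovl_len a b p H^-1; lia.
have L2 : ln (H * p) = (ln H - k)%N.
  by have := len_mul H p; rewrite (ovlC _ _ H^-1) pH; lia.
have HpH : ov (H * p) H = (ln H - k)%N.
  have := len_mulVg hab H (H * p); rewrite mulKg (ovlC _ _ H) L1 L2.
  by lia.
have HpQ : ov q (H * p) = k.
  have := ovl_ultra a b q H (H * p); rewrite qH (ovlC _ _ H) HpH.
  by have := ovl_len a b q (H * p); lia.
have E1 : G ^ q = q^-1 * p by [].
have E2 : (H * G) ^ q = q^-1 * (H * p) by rewrite /p; grp.
have := len_mulVg hab q p; have := len_mulVg hab q (H * p).
by rewrite E1 E2 HpQ L2 L1 qk; lia.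
Qed.

(** Induction on the total length. A pair that is not Nielsen reduced can be shortened, and
    [farey_M] carries the result back; for a reduced pair, [a] and [b] are among its entries and
    their inverses. *)
Theorem nielsen g h : free_basis g h -> farey g h.
Proof.
move: {-1}(ln g + ln h)%N (leqnn (ln g + ln h)) => n.
elim/ltn_ind: n g h => n IH g h gh_n gh.
pose ev := leval g h.
have N0 x : (0 < ln (ev x))%N.
  rewrite lt0n len_eq0 //; apply: (@free_basis_neq1 _ _ (ev (~~ x.1, x.2))).
  by apply: free_basis_letters => //=; case: (x.1).
have lev x y : x.1 != y.1 -> (ln (ev x) + ln (ev y) = ln g + ln h)%N.
  by case: x y => [[] []] [[] []] //= _; rewrite /ev /leval /= ?lenV //; lia.
have sq x : (2 * ov (ev x)^-1 (ev x) < ln (ev x))%N.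
  by apply: ovl_sqr => //; rewrite -(len_eq0 hab) -lt0n.
have [N1|] := pselect (forall x y, y != linv x ->
  (2 * ov (ev x)^-1 (ev y) <= ln (ev x))%N /\ (2 * ov (ev x)^-1 (ev y) <= ln (ev y))%N);
  last first.
  move=> /existsNP[x /existsNP[y /not_implyP[yx]]] viol.
  (* By [ovl_sqr] a letter cannot violate the bound against itself, so the violation involves both
     generators and a Nielsen move shortens one of them. *)
  have xy : x.1 != y.1.
    apply/eqP => xy; apply: viol; have -> : y = x.
      case: x y yx xy => [i e] [j f] /= + ij; rewrite /linv /= -ij.
      by rewrite xpair_eqE eqxx /=; case: e f => [] [].
    by have := sq x; lia.
  have L := len_mul (ev x) (ev y); have Lxy := lev _ _ xy.
  have B := free_basis_letters xy gh.
  apply: (farey_letters xy); rewrite -/ev.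
  have [v1|v1] := leqP (2 * ov (ev x)^-1 (ev y)) (ln (ev x)).
    have v2 : (ln (ev y) < 2 * ov (ev x)^-1 (ev y))%N.
      by rewrite ltnNge; apply/negP => v2; apply: viol.
    have : farey (ev x * ev y) (ev y).
      apply: (IH (ln (ev x * ev y) + ln (ev y))%N) => //; first by lia.
      exact: free_basisMr.
    move=> /farey_swap/farey_VE/farey_M.
    by move=> /farey_MC; rewrite mulgK => /farey_VE/farey_swap.
  have : farey (ev x) (ev x * ev y).
    apply: (IH (ln (ev x) + ln (ev x * ev y))%N) => //; first by lia.
    exact: free_basisM.
  by move=> /farey_VE/farey_M; rewrite mulKg => /farey_VE.
have [N2|] := pselect (forall x y z, y != linv x -> z != linv y ->
  (ov (ev x)^-1 (ev y) + ov (ev y)^-1 (ev z) < ln (ev y))%N); last first.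
  move=> /existsNP[x /existsNP[y /existsNP[z /not_implyP[yx /not_implyP[zy]]]]].
  move/negP; rewrite -leqNgt => viol.
  have [a1 a2] := N1 _ _ yx; have [a3 a4] := N1 _ _ zy.
  have l_xy u v : v != linv u -> u.1 = v.1 -> u = v.
    case: u v => [i e] [j f] /= + ij; rewrite /linv /= -ij.
    by rewrite xpair_eqE eqxx /=; case: e f => [] [].
  have sy := sq y.
  have xy : x.1 != y.1.
    by apply/eqP => /(l_xy _ _ yx) E; move: viol a1; rewrite E; lia.
  have yz : y.1 != z.1.
    by apply/eqP => /(l_xy _ _ zy) E; move: viol a3; rewrite -E; lia.
  (* Both outer letters belong to the same generator. Were they inverse to each other, both overlaps
     being half of [ev y], the ultrametric inequality would make [ev y] overlap its own inverse by
     half. *)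
  have zx : z = x.
    have [//|zx] := eqVneq z x.
    have zE : z = linv x.
      by case: x y z xy yz zx {viol a1 a2 a3 a4 yx zy sy}
        => [[] []] [[] []] [[] []].
    move: viol; rewrite zE [ev (linv x)]levalV -/(ev x).
    have := ovl_ultra a b (ev y)^-1 (ev x)^-1 (ev y).
    move: a3; rewrite zE [ev (linv x)]levalV -/(ev x); lia.
  have yx1 : y.1 != x.1 by rewrite eq_sym.
  have B := free_basis_letters yx1 gh.
  rewrite zx in viol a3 a4.
  (* Exactly half of [ev y] cancels against [ev x] on either side; the conjugated pair is in total
     no longer than [ev x] alone. *)
  have [q qlt] : exists q, (ln (ev y ^ q) + ln ((ev x * ev y) ^ q) <= ln (ev x))%N.
    by apply: ovl_half => //; rewrite -/ev; lia.
  apply: (farey_letters yx1); rewrite -/ev.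
  have : farey (ev y ^ q) ((ev x * ev y) ^ q).
    apply: (IH (ln (ev y ^ q) + ln ((ev x * ev y) ^ q))%N) => //.
      by have := lev _ _ xy; have := N0 y; lia.
    apply: free_basisJ.
    have -> : ev x * ev y = (ev y * ev x) ^ ev y by grp.
    have {1}-> : ev y = ev y ^ ev y by grp.
    exact/free_basisJ/free_basisM.
  by move=> /farey_J/farey_MC/farey_VE/farey_M; rewrite mulKg => /farey_VE.
have [xa ax] := nielsen_reduced_letter (c := a) N0 N1 N2
  ltac:(by rewrite /len nf_gen) gh.
have [xb bx] := nielsen_reduced_letter (c := b) N0 N1 N2
  ltac:(by rewrite /len nf_gen) gh.
have xab : xa.1 != xb.1.
  apply/eqP => E.
  have : b = a \/ b = a^-1.
    rewrite ax bx; case: xa xb E {ax bx} => [i e] [j f] /= ->.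
    by rewrite /leval; case: e f => [] [] /=; rewrite ?invgK; tauto.
  by case=> /(congr1 (nf a b)); rewrite ?nfV // !nf_gen.
by apply: (farey_letters xab); rewrite -ax -bx; exact: farey_ab.
Qed.

End Nielsen.

(** * Enumeration of the simple closed curves *)

Section CurveEnumeration.
Variables (F : groupType) (a b : F).
Hypothesis hab : free_basis a b.
Local Notation node := (gnode a b).

(** The left summand holds the two curves of the root edge; every other curve is indexed by the node
    at which it is the newly reached third curve. *)
Definition curve_rep (i : bool + bool * seq bool) : F :=
  match i with
  | inl false => a | inl true => b
  | inr (e, w) => ((node e w).1 * (node e w).2)%g
  end.

Definition curve i : set F := unoriented_class (curve_rep i).

Lemma unoriented_classJ (g h t : F) : (eqV (g ^ t) h)%g ->
  unoriented_class g = unoriented_class h.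
Proof.
have subV (x y : F) : (unoriented_class x `<=` unoriented_class y ->
    unoriented_class x `<=` unoriented_class y^-1)%g.
  by move=> xy z /xy [u [->|->]]; exists u; rewrite invgK; tauto.
move=> gh; have {gh} [E|E] : (h = g ^ t \/ h = (g ^ t)^-1)%g.
- by case: gh => ->; rewrite ?invgK; tauto.
- rewrite E; apply/seteqP; split=> x [u xu]; [exists (t^-1 * u)%g|exists (t * u)%g].
    by rewrite !conjgM -!conjVg !conjgK.
  by move: xu; rewrite -conjVg -!conjgM.
- rewrite E; apply/seteqP; split=> x [u xu]; [exists (t^-1 * u)%g|exists (t * u)%g].
    by rewrite invgK -conjVg !conjgM !conjgK; tauto.
  by move: xu; rewrite invgK -conjVg -!conjgM; tauto.
Qed.

Lemma gnode_basis e w : free_basis (node e w).1 (node e w).2.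
Proof.
rewrite /gnode; elim/last_ind: w => [|w c IH].
  by case: e => //=; exact: free_basisV.
rewrite foldl_rcons; move: (foldl _ _ _) IH => [g h] /= gh.
by case: c => /=; [exact: free_basisMr|exact: free_basisM].
Qed.

Lemma Omega_curve i : Omega (curve i).
Proof.
exists (curve_rep i) => //; case: i => [[]|[e w]] /=.
- by exists a; exact: free_basis_swap.
- by exists b.
- by exists (node e w).2; exact/free_basisMr/gnode_basis.
Qed.

Lemma gnode_curve e w : (exists i, unoriented_class (node e w).1 = curve i) /\
  (exists i, unoriented_class (node e w).2 = curve i).
Proof.
elim/last_ind: w => [|w c [IH1 IH2]].
  split; last by exists (inl true).
  exists (inl false); case: e => //=; apply: (@unoriented_classJ _ _ 1%g).
  by rewrite conjg1; right.
rewrite /gnode foldl_rcons -/(node e w).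
by case: c => /=; split=> //; exists (inr (e, w)).
Qed.

Lemma curve_Omega X : Omega X -> exists i, X = curve i.
Proof.
move=> [g [h gh] ->].
have [e [w H]] := nielsen hab gh; have [C1 C2] := gnode_curve e w.
by case: H => -[t [/unoriented_classJ E1 /unoriented_classJ E2]];
  rewrite ?E1 ?E2.
Qed.

(* If (g, h) is the pair at the word w, below a root (g0, h0), and (r, s) is
   farey_coords w, then gh = r g0 + s h0 in homology. *)
Fixpoint farey_coords (w : seq bool) : nat * nat :=
  if w is c :: w' then
    let p := farey_coords w' in
    if c then (p.1, p.1 + p.2)%N else (p.1 + p.2, p.2)%N
  else (1, 1)%N.

Lemma farey_coords_gt0 w : (0 < (farey_coords w).1)%N && (0 < (farey_coords w).2)%N.
Proof. by elim: w => [|[] w /andP[]] //=; lia. Qed.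

Lemma farey_coords_coprime w : coprime (farey_coords w).1 (farey_coords w).2.
Proof.
elim: w => [|[] w] //= IH; rewrite /coprime; first by rewrite gcdnDl.
by rewrite gcdnC gcdnDr gcdnC.
Qed.

(** This is the subtractive Euclidean algorithm: the coordinates are equal only for the empty word,
    and otherwise the larger one reveals the first letter. *)
Lemma farey_coords_inj : injective farey_coords.
Proof.
elim=> [|c w IH] [|d v] //=.
- by have := farey_coords_gt0 v; case: d => /andP[] ? ? []; lia.
- by have := farey_coords_gt0 w; case: c => /andP[] ? ? []; lia.
- have := farey_coords_gt0 v; have := farey_coords_gt0 w.
  move=> /andP[w1 w2] /andP[v1 v2].
  case: c; case: d => -[E1 E2]; try lia;
  by congr (_ :: _); apply/IH/injective_projections; lia.
Qed.

Lemma morph_farey (V : zmodType) (f : F -> V) (p : F * F) w :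
  {morph f : x y / (x * y)%g >-> x + y} ->
  let q := foldl (@gstep F) p w in
  f (q.1 * q.2)%g = f p.1 *+ (farey_coords w).1 + f p.2 *+ (farey_coords w).2.
Proof.
move=> fM; elim: w p => [|c w IH] p /=; first by rewrite fM !mulr1n.
by rewrite IH; case: c => /=; rewrite fM mulrnDl !mulrnDr addrA.
Qed.

(** The side with [e] true starts from the inverse of [a], whence the sign: it carries the negative
    slopes. *)
Definition slope_coords (i : bool + bool * seq bool) : int * int :=
  match i with
  | inl false => (1, 0) | inl true => (0, 1)
  | inr (e, w) => ((-1) ^+ e * (farey_coords w).1%:Z, (farey_coords w).2%:Z)
  end.

Lemma add_morphV (V : zmodType) (f : F -> V) x :
  {morph f : x y / (x * y)%g >-> x + y} -> f x^-1%g = - f x.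
Proof.
move=> fM; apply: (addIr (f x)); rewrite -fM mulVg addNr.
by apply: (addIr (f 1%g)); rewrite -fM mulg1 add0r.
Qed.

Lemma slope_coordsP i :
  homology_coords a b (curve_rep i) (slope_coords i).1 (slope_coords i).2.
Proof.
move=> V f fM; case: i => [[]|[e w]] /=.
- by rewrite mulr0z mulr1z add0r.
- by rewrite mulr0z mulr1z addr0.
- rewrite (morph_farey _ _ fM) /= -!pmulrn; congr (_ + _).
  case: e => /=; last by rewrite expr0 mul1r pmulrn.
  by rewrite (add_morphV _ fM) expr1 mulN1r mulrNz mulNrn pmulrn.
Qed.

(** The homomorphisms to the integers dual to the basis read off the coordinates; conjugation does
    not affect them, and inversion accounts for the common sign. *)
Lemma homology_coords_unique i (g : F) r s : curve i g ->
  homology_coords a b g r s -> exists e : bool,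
  r = (-1) ^+ e * (slope_coords i).1 /\ s = (-1) ^+ e * (slope_coords i).2.
Proof.
move=> ig grs.
have [f [[fM fa fb] _]] := hab (1 : mul_of_zmod int) (0 : mul_of_zmod int).
have [h [[hM ha hb] _]] := hab (0 : mul_of_zmod int) (1 : mul_of_zmod int).
have {}fM : {morph (f : F -> int) : x y / (x * y)%g >-> x + y} by [].
have {}hM : {morph (h : F -> int) : x y / (x * y)%g >-> x + y} by [].
have := slope_coordsP i fM; have := slope_coordsP i hM.
have := grs _ _ fM; have := grs _ _ hM.
rewrite fa fb ha hb !mul0rz !intz !addr0 !add0r => <- <- <- <-.
have [y gy] := ig.
have cJ (k : F -> int) : {morph k : x y / (x * y)%g >-> x + y} -> forall x, k (x ^ y)%g = k x.
  by move=> kM x; rewrite conjgE !kM (add_morphV _ kM) addrCA addNr addr0.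
case: gy => ->; [exists false|exists true]; rewrite ?cJ // ?mul1r //.
by rewrite !(add_morphV _ fM, add_morphV _ hM) !mulN1r.
Qed.

Lemma slope_coords_inj i j (e : bool) :
  (slope_coords i).1 = (-1) ^+ e * (slope_coords j).1 ->
  (slope_coords i).2 = (-1) ^+ e * (slope_coords j).2 -> i = j.
Proof.
case: i j => [[]|[d w]] [[]|[d' w']] //=;
  try (have /andP[] := farey_coords_gt0 w); try (have /andP[] := farey_coords_gt0 w').
all: try (case: d => /=); try (case: d' => /=); case: e => /=; rewrite ?(expr0, expr1).
all: try lia.
all: move=> ? ? ? ? ? ?; congr (inr (_, _)); apply/farey_coords_inj/injective_projections; lia.
Qed.

Lemma curve_inj : injective curve.
Proof.
move=> i j ij; have jj : curve j (curve_rep j) by exists 1%g; rewrite conjg1; left.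
rewrite -ij in jj; have [e [E1 E2]] := homology_coords_unique jj (slope_coordsP j).
exact/esym/(slope_coords_inj E1 E2).
Qed.

(* The three colours are the nonzero homology classes with coefficients in Z/2,
   written in the basis (a, b). *)
Definition addb2 (u v : bool * bool) : bool * bool := (u.1 (+) v.1, u.2 (+) v.2).

Definition hstep (p : (bool * bool) * (bool * bool)) (c : bool) :=
  if c then (addb2 p.1 p.2, p.2) else (p.1, addb2 p.1 p.2).

Definition hroot : (bool * bool) * (bool * bool) := ((true, false), (false, true)).

Definition colour (i : bool + bool * seq bool) : bool * bool :=
  match i with
  | inl false => (true, false) | inl true => (false, true)
  | inr (e, w) => let p := foldl hstep hroot w in addb2 p.1 p.2
  end.

Lemma colour_farey_coords p w : let q := foldl hstep p w in
  addb2 q.1 q.2 =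
  addb2 (odd (farey_coords w).1 && p.1.1, odd (farey_coords w).1 && p.1.2)
        (odd (farey_coords w).2 && p.2.1, odd (farey_coords w).2 && p.2.2).
Proof.
elim: w p => [|c w IH] [[x y] [z t]] //=; rewrite IH.
case: c; rewrite /addb2 /= oddD; case: (odd _); case: (odd _); case: x; case: y;
  case: z; case: t => //.
Qed.

Lemma colour_slope i :
  colour i = (odd `|(slope_coords i).1|%N, odd `|(slope_coords i).2|%N).
Proof.
case: i => [[]|[e w]] //; rewrite /colour colour_farey_coords /addb2 /= !andbT !andbF.
by rewrite addbF abszMsign.
Qed.

Lemma has_slope_curve i r s : has_slope a b (curve i) r s ->
  colour i = (odd `|r|%N, odd `|s|%N).
Proof.
move=> [_ [g ig /(homology_coords_unique ig) [e [-> ->]]]].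
by rewrite !abszMsign colour_slope.
Qed.

Lemma curve_slope i : has_slope a b (curve i) (slope_coords i).1 (slope_coords i).2.
Proof.
split; last first.
  by exists (curve_rep i); [exists 1%g; rewrite conjg1; left|exact: slope_coordsP].
case: i => [[]|[e w]] //=; rewrite coprimezE abszMsign.
exact: farey_coords_coprime.
Qed.

Lemma Omega1_curve i : Omega1 a b (curve i) <-> colour i = (true, false).
Proof.
split=> [[_ [r [s [/has_slope_curve -> -> /negPf->]]]]|] //.
rewrite colour_slope => -[E1 E2]; split; first exact: Omega_curve.
exists (slope_coords i).1, (slope_coords i).2; split; rewrite ?E1 ?E2 //.
exact: curve_slope.
Qed.

Lemma Omega2_curve i : Omega2 a b (curve i) <-> colour i = (false, true).
Proof.
split=> [[_ [r [s [/has_slope_curve -> /negPf-> ->]]]]|] //.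
rewrite colour_slope => -[E1 E2]; split; first exact: Omega_curve.
exists (slope_coords i).1, (slope_coords i).2; split; rewrite ?E1 ?E2 //.
exact: curve_slope.
Qed.

Lemma Omega3_curve i : Omega3 a b (curve i) <-> colour i = (true, true).
Proof.
split=> [[_ [r [s [/has_slope_curve -> -> ->]]]]|] //.
rewrite colour_slope => -[E1 E2]; split; first exact: Omega_curve.
exists (slope_coords i).1, (slope_coords i).2; split; rewrite ?E1 ?E2 //.
exact: curve_slope.
Qed.

End CurveEnumeration.

(** * Sums over the tree of Markoff triples *)

Section ComplexModulus.
Variable R : realType.
Implicit Types x y z : R[i].

(** The norm of [R[i]] takes values in [R[i]]; the estimates and limits need a modulus in the real
    field. *)
Definition cnorm (x : R[i]) : R := ComplexField.Normc.normc x.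

Lemma cnormE x : `|x| = (cnorm x)%:C.
Proof. by rewrite /cnorm normc_def; case: x. Qed.

Lemma cnorm_ge0 x : 0 <= cnorm x.
Proof. by rewrite -lecR -cnormE normr_ge0. Qed.

Lemma cnormM x y : cnorm (x * y) = cnorm x * cnorm y.
Proof. exact: ComplexField.Normc.normcM. Qed.

Lemma cnormV x : cnorm x^-1 = (cnorm x)^-1.
Proof. exact: ComplexField.Normc.normcV. Qed.

Lemma cnormN x : cnorm (- x) = cnorm x.
Proof. by apply: complexI; rewrite -!cnormE normrN. Qed.

Lemma cnormX x n : cnorm (x ^+ n) = cnorm x ^+ n.
Proof. by apply: complexI; rewrite -cnormE normrX cnormE rmorphXn. Qed.

Lemma cnorm_nat n : cnorm n%:R = n%:R.
Proof. by apply: complexI; rewrite -cnormE normr_nat rmorph_nat. Qed.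

Lemma cnorm_eq0 x : (cnorm x == 0) = (x == 0).
Proof. by rewrite -(inj_eq (@complexI R)) -cnormE normr_eq0. Qed.

Lemma cnorm_gt0 x : (0 < cnorm x) = (x != 0).
Proof. by rewrite lt_def cnorm_ge0 andbT cnorm_eq0. Qed.

Lemma cnormD x y : cnorm (x + y) <= cnorm x + cnorm y.
Proof. by rewrite -lecR rmorphD -!cnormE ler_normD. Qed.

Lemma cnormB x y : cnorm (x - y) <= cnorm x + cnorm y.
Proof. by rewrite -(cnormN y) cnormD. Qed.

Lemma cnorm_lebD x y : cnorm x - cnorm y <= cnorm (x + y).
Proof. by have := cnormB (x + y) y; rewrite addrK; lra. Qed.

Lemma cnorm_lebB x y : cnorm x - cnorm y <= cnorm (x - y).
Proof. by have := cnormD (x - y) y; rewrite subrK; lra. Qed.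

Lemma cnorm_parallelogram x y :
  cnorm (x + y) ^+ 2 + cnorm (x - y) ^+ 2 = 2 * cnorm x ^+ 2 + 2 * cnorm y ^+ 2.
Proof.
have E (u v : R) : cnorm (u +i* v) ^+ 2 = u ^+ 2 + v ^+ 2.
  by rewrite /cnorm /= sqr_sqrtr // addr_ge0 // sqr_ge0.
by case: x y => [u v] [u' v']; rewrite !E; ring.
Qed.

End ComplexModulus.

Section TreeSums.
Variables (S : Type) (step : S -> bool -> S).

Fixpoint tree_sum (V : zmodType) (f : S -> V) (n : nat) (q : S) : V :=
  if n is n'.+1 then
    f q + (tree_sum f n' (step q false) + tree_sum f n' (step q true))
  else 0.

Fixpoint level_sum (V : zmodType) (f : S -> V) (n : nat) (q : S) : V :=
  if n is n'.+1 then level_sum f n' (step q false) + level_sum f n' (step q true)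
  else f q.

Lemma tree_sum_level (V : zmodType) (f : S -> V) n q :
  tree_sum f n q = \sum_(m < n) level_sum f m q.
Proof.
elim: n q => [|n IH] q /=; first by rewrite big_ord0.
by rewrite big_ord_recl /= !IH -big_split.
Qed.

Lemma tree_sumZ (R : realType) (f : S -> R) (C : R) n q :
  tree_sum (fun q => C * f q) n q = C * tree_sum f n q.
Proof. by elim: n q => [|n IH] q /=; rewrite ?mulr0 // !IH !mulrDr. Qed.

Lemma le_tree_sum (R : realType) (f g : S -> R) n q :
  (forall w, f (foldl step q w) <= g (foldl step q w)) ->
  tree_sum f n q <= tree_sum g n q.
Proof.
elim: n q => [|n IH] q fg //=; apply: lerD; first exact: (fg [::]).
by apply: lerD; apply: IH => w; [exact: (fg (false :: w))|exact: (fg (true :: w))].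
Qed.

End TreeSums.

Section MarkoffTree.
Variable R : realType.
Implicit Types (x y z : R[i]) (q : R[i] * R[i] * R[i]).

Definition tstep q (c : bool) :=
  let: (x, y, z) := q in if c then (z, y, z * y - x) else (x, z, x * z - y).

Definition swap q := let: (x, y, z) := q in (y, x, z).

Lemma tstep_swap q c : tstep (swap q) c = swap (tstep q (~~ c)).
Proof. by case: q c => [[x y] z] [] /=; rewrite mulrC. Qed.

(** The configuration in which the edge term is of order 1/|xy|. The last clause follows from |xy -
    z| <= |z|, that is, when the trace across the edge is not the larger one. *)
Definition admissible q := let: (x, y, z) := q in
  [&& cnorm x <= cnorm z, cnorm y <= cnorm z & cnorm (x * y) <= 2 * cnorm z].

(* The last term makes a bound on the sum of the weights over the tree also bound
   the number of nodes that are not admissible. *)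
Definition weight q : R := let: (x, y, z) := q in
  (cnorm z)^-1 + (cnorm (x * y))^-1 + (~~ admissible (x, y, z))%:R.

Lemma weight_ge0 q : 0 <= weight q.
Proof.
by case: q => [[x y] z]; rewrite /weight !addr_ge0 // ?invr_ge0 ?cnorm_ge0.
Qed.

Lemma weight_swap q : weight (swap q) = weight q.
Proof.
case: q => [[x y] z]; rewrite /weight /swap /admissible (mulrC y).
by rewrite andbCA.
Qed.

Local Notation tsum := (tree_sum tstep weight).

Lemma tsum_swap n q : tsum n (swap q) = tsum n q.
Proof.
elim: n q => [|n IH] q //=; rewrite weight_swap !tstep_swap !IH /=.
by congr (_ + _); rewrite addrC.
Qed.

Definition good q := exists C, forall n, tsum n q <= C.

Lemma good_swap q : good (swap q) -> good q.
Proof. by move=> [C H]; exists C => n; rewrite -tsum_swap. Qed.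

Lemma good_step q : good (tstep q false) -> good (tstep q true) -> good q.
Proof.
move=> [C HC] [D HD]; exists (weight q + (C + D)) => -[|n] /=.
  rewrite addr_ge0 ?weight_ge0 // addr_ge0 //.
    by apply: le_trans (HC 0%N).
  by apply: le_trans (HD 0%N).
by rewrite !lerD.
Qed.

Definition outward q := let: (x, y, z) := q in
  [&& 2 < cnorm x, 2 < cnorm y & cnorm (x * y) <= 2 * cnorm z].

(* The sum of X^r Y^s over all r, s >= 1; the coprime pairs (r, s) run through
   the Farey tree. *)
Definition branch_bound (X Y : R) := X * Y / ((1 - X) * (1 - Y)).

(** Sorting the pairs (r, s) by r = s, r > s and r < s splits [branch_bound X Y] into W/(1 - W),
    [branch_bound X W] and [branch_bound W Y], where W = XY. Then Z <= W, and the terms r = s >= 2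
    are given away. *)
Lemma branch_bound_rec (X Y Z : R) : 0 < X < 1 -> 0 < Y < 1 -> 0 < Z <= X * Y ->
  X * Y + (branch_bound X Z + branch_bound Z Y) <= branch_bound X Y.
Proof.
move=> /andP[X0 X1] /andP[Y0 Y1] /andP[Z0 ZXY].
have W0 : 0 < X * Y by exact: mulr_gt0.
have W1 : X * Y < 1 by nra.
move EW: (X * Y) ZXY W0 W1 => W ZXY W0 W1.
have mono (T : R) : 0 < T < 1 -> T * Z / ((1 - T) * (1 - Z)) <= T * W / ((1 - T) * (1 - W)).
  move=> /andP[T0 T1]; rewrite -!mulrA ler_pM2l //.
  have A0 : 0 < (1 - T) * (1 - W) by rewrite mulr_gt0 ?subr_gt0.
  have AB : (1 - T) * (1 - W) <= (1 - T) * (1 - Z) by rewrite ler_pM2l; lra.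
  have A1 : 0 < (1 - T) * (1 - Z) by exact: lt_le_trans AB.
  apply: ler_pM; rewrite ?invr_ge0 ?lef_pV2 ?posrE //; exact: ltW.
rewrite /branch_bound (mulrC Z) (mulrC (1 - Z)) EW.
apply: (@le_trans _ _ (W + (X * W / ((1 - X) * (1 - W)) + Y * W / ((1 - Y) * (1 - W))))).
  by rewrite lerD2l lerD // mono ?X0 ?Y0.
have -> : W / ((1 - X) * (1 - Y)) = (W + (X * W / ((1 - X) * (1 - W)) +
    Y * W / ((1 - Y) * (1 - W)))) + W ^+ 2 / (1 - W).
  by rewrite -EW in W1 *; field; rewrite !subr_eq0; apply/and3P; split; lra.
by rewrite lerDl divr_ge0 ?sqr_ge0 //; lra.
Qed.

(** Since |xz| >= |x||xy|/2 >= 2|y|, subtracting y from xz loses at most half; the other step is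
    symmetric. *)
Lemma outward_step q c : outward q -> outward (tstep q c).
Proof.
wlog: q c / c = false.
  case: c => [H|H]; last exact: H.
  case: q => [[x y] z] xyz.
  have /(_ erefl) := H (y, x, z) false.
  rewrite /= [y * x]mulrC andbCA => /(_ xyz).
  by rewrite (mulrC y z) [z * y in X in X -> _]mulrC andbCA; rewrite mulrC.
move=> ->; case: q => [[x y] z] /and3P[x2 y2]; rewrite /= !cnormM => xyz.
have y0 := cnorm_ge0 y; have z2 : 2 < cnorm z by nra.
rewrite x2 z2 /=; have := cnorm_lebB (x * z) y; rewrite cnormM.
nra.
Qed.

(** In terms of X = 2/|x| and Y = 2/|y| the growth condition reads 2/|z| <= XY, and the weight is at
    most 3/|xy|, below XY = 4/|xy|. *)
Lemma outward_weight x y z : outward (x, y, z) ->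
  weight (x, y, z) <= 2 / cnorm x * (2 / cnorm y) /\
  0 < 2 / cnorm z <= 2 / cnorm x * (2 / cnorm y).
Proof.
move=> /and3P[x2 y2 xyz].
have z2 : 2 < cnorm z by move: xyz; rewrite cnormM; nra.
have adm : admissible (x, y, z).
  rewrite /= xyz; move: xyz; rewrite cnormM => xyz.
  by apply/and3P; split=> //; nra.
have [x0 y0 z0] : [/\ 0 < cnorm x, 0 < cnorm y & 0 < cnorm z] by split; lra.
have Z : 2 / cnorm z <= 2 / cnorm x * (2 / cnorm y).
  have -> : 2 / cnorm x * (2 / cnorm y) = 4 / cnorm (x * y).
    by rewrite cnormM; field; rewrite !gt_eqF.
  have xy0 : 0 < cnorm (x * y) by rewrite cnormM mulr_gt0.
  by rewrite ler_pdivrMr // mulrAC ler_pdivlMr //; lra.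
split; last by rewrite Z divr_gt0.
rewrite /weight adm addr0 cnormM invfM.
have := Z; have xi : 0 < (cnorm x)^-1 by rewrite invr_gt0.
have yi : 0 < (cnorm y)^-1 by rewrite invr_gt0.
nra.
Qed.

Lemma outward_sum n x y z : outward (x, y, z) ->
  tsum n (x, y, z) <= branch_bound (2 / cnorm x) (2 / cnorm y).
Proof.
have inv01 (u : R[i]) : 2 < cnorm u -> 0 < 2 / cnorm u < 1.
  by move=> u2; rewrite divr_gt0 ?ltr_pdivrMr ?mul1r //; lra.
elim: n x y z => [|n IH] x y z xyz.
  have /and3P[/inv01 /andP[x0 x1] /inv01 /andP[y0 y1] _] := xyz.
  by rewrite /= /branch_bound divr_ge0 ?mulr_ge0 //; lra.
have [w1 w2] := outward_weight xyz; have /and3P[x2 y2 _] := xyz.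
apply: le_trans (branch_bound_rec (inv01 _ x2) (inv01 _ y2) w2).
rewrite /= lerD // lerD //.
  exact: IH (outward_step false xyz).
exact: IH (outward_step true xyz).
Qed.

Lemma outward_good q : outward q -> good q.
Proof.
case: q => [[x y] z] xyz; exists (branch_bound (2 / cnorm x) (2 / cnorm y)) => n.
exact: outward_sum.
Qed.

End MarkoffTree.

(** * Traces of the neighbours of a single curve *)

Section Rays.
Variable R : realType.
Implicit Types (x y z l m : R[i]) (q : R[i] * R[i] * R[i]).
Local Notation step := (@tstep R).
Local Notation tsum := (tree_sum step (@weight R)).

Lemma exp_unbounded (r M : R) : 1 < r -> exists k, forall n, (k <= n)%N -> M <= r ^+ n.
Proof.
move=> r1; have bern n : 1 + n%:R * (r - 1) <= r ^+ n.
  elim: n => [|n IH]; first by rewrite mul0r addr0 expr0.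
  rewrite exprS -natr1; have n0 : 0 <= n%:R * (r - 1) ^+ 2 by rewrite mulr_ge0 ?sqr_ge0.
  have IH' : r * (1 + n%:R * (r - 1)) <= r * r ^+ n by rewrite ler_pM2l; lra.
  by apply: le_trans IH'; rewrite -subr_ge0; apply: le_trans n0 _; rewrite le_eqVlt; apply/orP; left; apply/eqP; ring.
have [k kM] : exists k : nat, M / (r - 1) < k%:R.
  by exists (Num.truncn `|M / (r - 1)|).+1; rewrite (le_lt_trans (ler_norm _)) // truncnS_gt.
exists k => n kn; apply: le_trans (bern n).
have kn' : k%:R <= n%:R :> R by rewrite ler_nat.
move: kM; rewrite ltr_pdivrMr; last by lra.
by nra.
Qed.

(** [l] is the smaller eigenvalue of a matrix of determinant one and trace [x]. *)
Definition hyperbolic x l := [/\ l != 0, cnorm l < 1 & x = l + l^-1].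

Lemma iter_tstep_rec (y : nat -> R[i]) x k :
  (forall n, y n.+2 = x * y n.+1 - y n) ->
  iter k (step^~ false) (x, y 0%N, y 1%N) = (x, y k, y k.+1).
Proof. by move=> yS; elim: k => //= k ->; rewrite yS. Qed.

(** Along the ray |y_n| grows like |A| r^n; the branch leaving at the j-th node is outward with sum
    O(r^-j), and the geometric series converges. The bound on |x| eventually makes the nodes of the
    ray admissible. *)
Lemma ray_good_growth x m (A B : R[i]) (y : nat -> R[i]) :
  x != 0 -> 1 < cnorm m -> cnorm x < 2 * cnorm m -> A != 0 ->
  (forall n, y n.+2 = x * y n.+1 - y n) ->
  (forall n, y n = A * m ^+ n + B * m^-1 ^+ n) ->
  exists k, good (x, y k, y k.+1).
Proof.
move=> x0 m1 xm A0 yS yE.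
pose r := cnorm m; pose a := cnorm A; pose be := cnorm B; pose X := cnorm x.
have [r1 a0 be0 X0 Xr] : [/\ 1 < r, 0 < a, 0 <= be, 0 < X & X < 2 * r].
  by split; rewrite /r /a /be /X ?cnorm_gt0 ?cnorm_ge0.
have near n : a * r ^+ n - be <= cnorm (y n) <= a * r ^+ n + be.
  have E1 : cnorm (A * m ^+ n) = a * r ^+ n by rewrite cnormM cnormX.
  have E2 : cnorm (B * m^-1 ^+ n) <= be.
    rewrite cnormM cnormX cnormV -/r ler_piMr // exprn_ile1 // ?invr_ge0 ?invf_le1; lra.
  have := cnormD (A * m ^+ n) (B * m^-1 ^+ n).
  have := cnorm_lebD (A * m ^+ n) (B * m^-1 ^+ n).
  by rewrite -yE E1; lra.
(* The terms of [M] are the thresholds at which the inequalities of [big] set in. *)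
pose M := 2 * be + 8 + 2 * X + 2 * be / (r - 1) + be * (X + 2) / (2 * r - X).
have [k kM] := exp_unbounded (M / a) r1.
have big n : (k <= n)%N -> [/\ 2 * be <= a * r ^+ n, 8 <= a * r ^+ n,
    2 * X <= a * r ^+ n, 2 * be <= a * r ^+ n * (r - 1) &
    be * (X + 2) <= a * r ^+ n * (2 * r - X)].
  move=> /kM; rewrite ler_pdivrMr // mulrC; set t := a * r ^+ n => tM.
  have h1 : 0 <= 2 * be / (r - 1) by rewrite divr_ge0 ?mulr_ge0 //; lra.
  have h2 : 0 <= be * (X + 2) / (2 * r - X) by rewrite divr_ge0 ?mulr_ge0 //; lra.
  have h0 : 0 <= be * (X + 2) by rewrite mulr_ge0 //; lra.
  rewrite /M in tM.
  have e1 : 2 * be <= t * (r - 1) by rewrite -ler_pdivrMr ?subr_gt0 //; lra.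
  have e2 : be * (X + 2) <= t * (2 * r - X) by rewrite -ler_pdivrMr ?subr_gt0 //; lra.
  by split=> //; lra.
have half n : (k <= n)%N -> a * r ^+ n / 2 <= cnorm (y n).
  by move=> /big[b1 _ _ _ _]; have /andP[] := near n; lra.
exists k.
(* [c1] adds the weight of a node, 2/a (1 + 1/X), to its side branch, 8/a, both in units of r^-j;
   [D] sums the geometric series, so D/r^j = c1/r^j + D/r^(j+1). *)
pose c1 := 2 / a * (1 + X^-1) + 8 / a; pose D := c1 * r / (r - 1).
have c10 : 0 < c1 by rewrite /c1 !addr_gt0 ?mulr_gt0 ?addr_gt0 ?invr_gt0.
have D0 : 0 < D by rewrite /D divr_gt0 ?mulr_gt0 //; lra.
suff bound n j : (k <= j)%N -> tsum n (x, y j, y j.+1) <= D / r ^+ j.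
  by exists (D / r ^+ k) => n; exact: bound.
elim: n j => [|n IH] j kj; first by rewrite /= divr_ge0 ?exprn_ge0 //; lra.
have kj1 : (k <= j.+1)%N by exact: leqW.
have [b1 b2 b3 b4 b5] := big j kj.
have [_ b2' _ _ _] := big j.+1 kj1.
have [h1 h2] := (half j kj, half j.+1 kj1).
have /andP[n1 n2] := near j; have /andP[n3 n4] := near j.+1.
set t := a * r ^+ j in b1 b2 b3 b4 b5 h1 n1 n2.
have t1 : a * r ^+ j.+1 = t * r by rewrite exprS /t; ring.
rewrite t1 in h2 n3 n4 b2'.
have t0 : 0 < t by lra.
have aN : a != 0 by rewrite gt_eqF.
have XN : X != 0 by rewrite gt_eqF.
have r0 : 0 < r by lra.
have rN : r != 0 by rewrite gt_eqF.
have rjN : r ^+ j != 0 by rewrite gt_eqF ?exprn_gt0.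
have r1N : r - 1 != 0 by rewrite gt_eqF ?subr_gt0.
have tr : t <= t * r by nra.
have y4 : 4 <= cnorm (y j) by lra.
have y4' : 4 <= cnorm (y j.+1) by lra.
have adm : admissible (x, y j, y j.+1).
  rewrite /admissible cnormM -/X; apply/and3P; split; [lra|nra|].
  by apply: (@le_trans _ _ (X * (t + be))); [rewrite ler_pM2l|nra].
have out : outward (y j.+1, y j, y j.+1 * y j - x).
  apply/and3P; split; [lra|lra|].
  have := cnorm_lebB (y j.+1 * y j) x; rewrite !cnormM -/X.
  have : 2 * X <= cnorm (y j.+1) * cnorm (y j) by nra.
  by lra.
have W : weight (x, y j, y j.+1) <= 2 / a * (1 + X^-1) / r ^+ j.
  rewrite /weight adm addr0.
  have -> : 2 / a * (1 + X^-1) / r ^+ j = (t / 2)^-1 + X^-1 * (t / 2)^-1.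
    by rewrite /t; field; rewrite ?aN ?XN ?rN ?rjN ?r1N.
  rewrite cnormM invfM lerD // ?ler_pM2l ?invr_gt0 // lef_pV2 ?posrE; lra.
have O : tsum n (y j.+1, y j, y j.+1 * y j - x) <= 8 / a / r ^+ j.
  apply: le_trans (outward_sum n out) _.
  have inv12 (u : R) : 4 <= u -> 0 < 2 / u <= 1 / 2.
    move=> u4; have u0 : 0 < u by lra.
    by apply/andP; split; [rewrite divr_gt0|rewrite ler_pdivrMr //; lra].
  have /andP[Y0 Y1] := inv12 _ y4; have /andP[Z0 Z1] := inv12 _ y4'.
  apply: (@le_trans _ _ (2 * (2 / cnorm (y j)))).
    rewrite /branch_bound ler_pdivrMr; last by rewrite mulr_gt0; lra.
    move: (2 / cnorm (y j)) (2 / cnorm (y j.+1)) Y0 Y1 Z0 Z1 => Y Z Y0 Y1 Z0 Z1.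
    have h : 1 / 4 <= (1 - Z) * (1 - Y) by nra.
    apply: (@le_trans _ _ (2 * Y * (1 / 4))); first by nra.
    by rewrite ler_pM2l //; lra.
  have -> : 8 / a / r ^+ j = 2 * (2 / (t / 2)).
    by rewrite /t; field; rewrite ?aN ?XN ?rN ?rjN ?r1N.
  by rewrite !ler_pM2l // lef_pV2 ?posrE; lra.
have S := IH j.+1 kj1.
have E : D / r ^+ j = 2 / a * (1 + X^-1) / r ^+ j + (D / r ^+ j.+1 + 8 / a / r ^+ j).
  by rewrite /D exprS /c1; field; rewrite ?aN ?XN ?rN ?rjN ?r1N.
by rewrite E /= -yS lerD // lerD.
Qed.

(** The traces around the curve are A l^-n + B l^n, where A is a nonzero multiple of z - l y;
    moreover |x| <= |l| + 1/|l| < 2/|l|. *)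
Lemma ray_good x y z l : hyperbolic x l -> z != l * y ->
  exists k, good (iter k (step^~ false) (x, y, z)).
Proof.
move=> [l0 l1 xE] zly.
have l0' : 0 < cnorm l by rewrite cnorm_gt0.
have m1 : 1 < cnorm l^-1 by rewrite cnormV invf_gt1.
have d0 : l^-1 - l != 0.
  by apply/eqP => /eqP; rewrite subr_eq0 => /eqP E; move: m1; rewrite E; lra.
pose A := (z - l * y) / (l^-1 - l); pose B := (l^-1 * y - z) / (l^-1 - l).
have l2 : 1 - l ^+ 2 != 0.
  by apply: contraNneq d0 => E; rewrite -(mulfK l0 (_ - _)) mulrBl mulVf // -expr2 E mul0r.
pose Y n := A * l^-1 ^+ n + B * l ^+ n.
have YS n : Y n.+2 = x * Y n.+1 - Y n.
  by rewrite /Y xE !exprS; field.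
have Y0 : Y 0%N = y by rewrite /Y /A /B !expr0; field; rewrite l0 mulNr -expr2.
have Y1 : Y 1%N = z by rewrite /Y /A /B !expr1; field; rewrite l0 mulNr -expr2.
have x0 : x != 0.
  rewrite xE addrC addr_eq0; apply/eqP => E.
  by move: m1; rewrite E cnormN; lra.
have [|||k kg] := @ray_good_growth x l^-1 A B Y x0 m1 _ _ YS.
- by rewrite xE; have := cnormD l l^-1; lra.
- by rewrite mulf_neq0 ?invr_eq0 // subr_eq0.
- by move=> n; rewrite invrK.
by exists k; rewrite -Y0 -Y1 iter_tstep_rec.
Qed.

(** In the complementary case A = 0 the traces are l^n y and tend to zero, in conflict with finitely
    many small traces. *)
Lemma ray_decay x y z l (M : R) : hyperbolic x l -> z = l * y -> 0 < M ->
  exists k, forall n, (k <= n)%N ->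
  cnorm (iter n (step^~ false) (x, y, z)).2 <= M.
Proof.
move=> [l0 l1 xE] zly M0; have l0' : 0 < cnorm l by rewrite cnorm_gt0.
pose Y n := y * l ^+ n.
have YS n : Y n.+2 = x * Y n.+1 - Y n by rewrite /Y xE !exprS; field.
have -> : (x, y, z) = (x, Y 0%N, Y 1%N) by rewrite /Y expr0 expr1 mulr1 zly mulrC.
have m1 : 1 < (cnorm l)^-1 by rewrite invf_gt1.
have [k kM] := exp_unbounded (cnorm y / M) m1.
exists k => n kn; rewrite iter_tstep_rec //= cnormM cnormX.
have /kM : (k <= n.+1)%N by exact: leqW.
rewrite exprVn ler_pdivrMr // mulrC -ler_pdivrMr ?invr_gt0 ?exprn_gt0 //.
by rewrite invrK.
Qed.

End Rays.

(** * Summability over the tree *)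

Section Descent.
Variable R : realType.
Implicit Types (x y z l m : R[i]) (q : R[i] * R[i] * R[i]).
Local Notation step := (@tstep R).

Definition markoff q := let: (x, y, z) := q in x ^+ 2 + y ^+ 2 + z ^+ 2 - x * y * z.

Lemma markoff_step q c : markoff (step q c) = markoff q.
Proof. by case: q c => [[x y] z] []; rewrite /=; ring. Qed.

Lemma markoff_foldl q w : markoff (foldl step q w) = markoff q.
Proof. by elim: w q => //= c w IH q; rewrite IH markoff_step. Qed.

(** By the parallelogram law |u - v|^2 <= 4 (2 + e)^2 - 16 = 16 e + 4 e^2. *)
Lemma near_two_dist (e : R) (u v : R[i]) : 0 < e < 1 ->
  cnorm u <= 2 + e -> cnorm v <= 2 + e -> 4 <= cnorm (u + v) ->
  cnorm (u - v) ^+ 2 <= 20 * e.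
Proof.
move=> /andP[e0 e1] u2 v2 uv; have := cnorm_parallelogram u v.
have u0 := cnorm_ge0 u; have v0 := cnorm_ge0 v.
have : cnorm u ^+ 2 <= (2 + e) ^+ 2 by rewrite ler_sqr ?nnegrE //; lra.
have : cnorm v ^+ 2 <= (2 + e) ^+ 2 by rewrite ler_sqr ?nnegrE //; lra.
have : 4 ^+ 2 <= cnorm (u + v) ^+ 2 by rewrite ler_sqr ?nnegrE ?cnorm_ge0 //; lra.
nra.
Qed.

(* If all of |x|, |y|, |z|, |xy - z|, |xz - y| are close to 2 then xy is close to
   2z and xz to 2y, which forces x^2 close to 4 and y^2 close to z^2. *)
Lemma near_two_markoff (e : R) x y z : 0 < e < 1 ->
  2 <= cnorm x <= 2 + e -> 2 <= cnorm y <= 2 + e -> 2 <= cnorm z <= 2 + e ->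
  cnorm (x * y - z) <= 2 + e -> cnorm (x * z - y) <= 2 + e ->
  cnorm (markoff (x, y, z) - 4) ^+ 2 <= 32 * 40 * e.
Proof.
move=> e01 /andP[x2 x3] /andP[y2 y3] /andP[z2 z3] u3 w3.
have [e0 e1] := andP e01.
have A : cnorm (2 * z - x * y) ^+ 2 <= 20 * e.
  have -> : 2 * z - x * y = z - (x * y - z) by ring.
  by apply: near_two_dist => //; rewrite addrC subrK cnormM; nra.
have B : cnorm (2 * y - x * z) ^+ 2 <= 20 * e.
  have -> : 2 * y - x * z = y - (x * z - y) by ring.
  by apply: near_two_dist => //; rewrite addrC subrK cnormM; nra.
move: A B; set al := 2 * z - _; set be := 2 * y - _ => A B.
have z0 : z != 0 by rewrite -cnorm_gt0; lra.
have -> : markoff (x, y, z) - 4 =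
    (y * be + z * al) / 2 - (2 * al + x * be) / z.
  by rewrite /markoff /al /be; field; rewrite z0.
have a0 := cnorm_ge0 al; have b0 := cnorm_ge0 be.
have H : cnorm ((y * be + z * al) / 2 - (2 * al + x * be) / z) <=
    4 * (cnorm al + cnorm be).
  apply: le_trans (cnormB _ _) _.
  rewrite !(cnormM _ _^-1) !cnormV cnorm_nat.
  have h1 := cnormD (y * be) (z * al); have h2 := cnormD (2 * al) (x * be).
  rewrite !cnormM ?cnorm_nat in h1 h2.
  have h3 : cnorm (2 * al + x * be) / cnorm z <= cnorm (2 * al + x * be) / 2.
    by rewrite ler_wpM2l ?cnorm_ge0 // lef_pV2 ?posrE; lra.
  have h4 : cnorm y * cnorm be <= 3 * cnorm be by rewrite ler_wpM2r //; lra.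
  have h5 : cnorm z * cnorm al <= 3 * cnorm al by rewrite ler_wpM2r //; lra.
  have h6 : cnorm x * cnorm be <= 3 * cnorm be by rewrite ler_wpM2r //; lra.
  by lra.
set t := cnorm (_ - _) in H *; have t0 : 0 <= t := cnorm_ge0 _.
have : t ^+ 2 <= (4 * (cnorm al + cnorm be)) ^+ 2 by rewrite ler_sqr ?nnegrE //; lra.
nra.
Qed.

(** The quantity to follow is [M n], the larger modulus on the edge: each step drops the curve that
    attains it, so it cannot increase. *)
Lemma descending_markoff (x y z : nat -> R[i]) (c : nat -> bool) mu :
  (forall n, step (x n, y n, z n) (c n) = (x n.+1, y n.+1, z n.+1)) ->
  (forall n, markoff (x n, y n, z n) = mu) ->
  (forall n, [/\ 2 < cnorm (x n), 2 < cnorm (y n) & 2 < cnorm (z n)]) ->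
  (forall n, 2 * cnorm (z n) < cnorm (x n * y n)) ->
  (forall n b, exists2 k, (n <= k)%N & c k = b) ->
  mu = 4.
Proof.
move=> cS cmu c2 cdesc cturn.
pose M n := Num.max (cnorm (x n)) (cnorm (y n)).
have stepF n : c n = false -> [/\ x n.+1 = x n, y n.+1 = z n,
    z n.+1 = x n * z n - y n & cnorm (x n * z n) < 2 * cnorm (y n)].
  move=> cn; have := cS n; rewrite cn /= => -[E1 E2 E3].
  split=> //; have := cdesc n.+1; rewrite -E3 -E1 -E2.
  by have := cnorm_lebB (x n * z n) (y n); lra.
have stepT n : c n = true -> [/\ x n.+1 = z n, y n.+1 = y n,
    z n.+1 = z n * y n - x n & cnorm (z n * y n) < 2 * cnorm (x n)].
  move=> cn; have := cS n; rewrite cn /= => -[E1 E2 E3].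
  split=> //; have := cdesc n.+1; rewrite -E3 -E1 -E2.
  by have := cnorm_lebB (z n * y n) (x n); lra.
have dropF n : c n = false -> [/\ M n = cnorm (y n), cnorm (x n) < cnorm (y n)
    & cnorm (z n) < cnorm (y n)].
  move=> /stepF[_ _ _]; have [x2 y2 z2] := c2 n; rewrite cnormM => h.
  by rewrite /M; split; [apply/max_idPr; nra|nra|nra].
have dropT n : c n = true -> [/\ M n = cnorm (x n), cnorm (y n) < cnorm (x n)
    & cnorm (z n) < cnorm (x n)].
  move=> /stepT[_ _ _]; have [x2 y2 z2] := c2 n; rewrite cnormM => h.
  by rewrite /M; split; [apply/max_idPl; nra|nra|nra].
have Mz n : cnorm (z n) <= M n.
  case E: (c n); [have [-> _ h] := dropT _ E|have [-> _ h] := dropF _ E];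
  exact: ltW.
have Mdecr n : M n.+1 <= M n.
  rewrite {1}/M ge_max; case E: (c n).
    by have [-> -> _ _] := stepT _ E; rewrite Mz /M le_max lexx orbT.
  by have [-> -> _ _] := stepF _ E; rewrite Mz /M le_max lexx.
have Mmono n k : (n <= k)%N -> M k <= M n.
  move=> /subnKC<-; elim: (k - n)%N => [|j IH]; first by rewrite addn0.
  by rewrite addnS; exact: le_trans (Mdecr _) IH.
have Mpos n : 2 < M n by have [x2 _ _] := c2 n; rewrite /M lt_max x2.
(* The path keeps turning, so every entry is dropped at some time, and then it is the maximum; hence
   a lower bound on all [M k] bounds all entries. *)
have keepx n : exists k, cnorm (x n) = M k.
  have [k /subnKC <-] := cturn n true.
  move: (k - n)%N => j; elim: j n => [|j IH] n; first by rewrite addn0 => /dropT[<- _ _]; exists n.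
  rewrite addnS -addSn; case E: (c n); first by have [<- _ _] := dropT _ E; exists n.
  by move=> h; have [k0] := IH _ h; have [-> _ _ _] := stepF _ E; exists k0.
have keepy n : exists k, cnorm (y n) = M k.
  have [k /subnKC <-] := cturn n false.
  move: (k - n)%N => j; elim: j n => [|j IH] n; first by rewrite addn0 => /dropF[<- _ _]; exists n.
  rewrite addnS -addSn; case E: (c n); last by have [<- _ _] := dropF _ E; exists n.
  by move=> h; have [k0] := IH _ h; have [_ -> _ _] := stepT _ E; exists k0.
have Msmall (e : R) : 0 < e -> exists n, M n <= 2 + e.
  move=> e0; apply/not_existsP => Mbig.
  have {}Mbig n : 2 + e < M n by rewrite ltNge; apply/negP.
  have xb n : 2 + e < cnorm (x n) by have [k ->] := keepx n.
  have yb n : 2 + e < cnorm (y n) by have [k ->] := keepy n.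
  (* Both new entries exceed 2 + e while their product is below 2 [M n], so each is below 2 [M n] /
     (2 + e). *)
  have grow n : M n.+1 * (1 + e / 2) <= M n.
    have [xb' yb'] := (xb n.+1, yb n.+1).
    have : cnorm (x n.+1 * y n.+1) < 2 * M n.
      case E: (c n).
        by have [-> -> _] := stepT _ E; have [-> _ _] := dropT _ E.
      by have [-> -> _] := stepF _ E; have [-> _ _] := dropF _ E.
    rewrite cnormM; move: (M n) => t ht; rewrite /M.
    move: (cnorm (x n.+1)) (cnorm (y n.+1)) xb' yb' ht => X Y X2 Y2 ht.
    have h1 : 0 <= (X - (2 + e)) * Y by rewrite mulr_ge0; lra.
    have h2 : 0 <= (Y - (2 + e)) * X by rewrite mulr_ge0; lra.
    by have [_|_] := leP X Y; lra.
  have pw n : M n * (1 + e / 2) ^+ n <= M 0%N.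
    elim: n => [|n IH]; first by rewrite expr0 mulr1.
    apply: le_trans IH; rewrite exprS mulrA ler_wpM2r ?grow // exprn_ge0 //; lra.
  have [|k kM] := @exp_unbounded R (1 + e / 2) (M 0%N); first by lra.
  have := kM k (leqnn k); have := pw k; have := Mpos k; have := Mpos 0%N.
  move: (_ ^+ k) (M k) (M 0%N) => r s t h1 h2 h3 h4.
  have : 0 <= (s - 2) * r by rewrite mulr_ge0; lra.
  by lra.
apply/eqP; rewrite -subr_eq0 -cnorm_eq0; apply/negPn/negP => mu4.
have d0 : 0 < cnorm (mu - 4) ^+ 2 by rewrite exprn_gt0 // lt_def mu4 cnorm_ge0.
set d := cnorm (mu - 4) ^+ 2 in d0.
pose e := Num.min (1 / 2) (d / 64 / 40).
have e0 : 0 < e by rewrite /e lt_min !divr_gt0.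
have e1 : e <= 1 / 2 by rewrite /e ge_min lexx.
have ed : 32 * 40 * e < d.
  have : e <= d / 64 / 40 by rewrite /e ge_min lexx orbT.
  by lra.
have [n Mn] := Msmall e e0.
have b k : (n <= k)%N -> [/\ 2 <= cnorm (x k) <= 2 + e, 2 <= cnorm (y k) <= 2 + e &
    2 <= cnorm (z k) <= 2 + e].
  move=> /Mmono Mk; have [x2 y2 z2] := c2 k; have := Mz k.
  have : cnorm (x k) <= M k by rewrite /M le_max lexx.
  have : cnorm (y k) <= M k by rewrite /M le_max lexx orbT.
  by move=> h1 h2 h3; split; lra.
(* At [n.+1] the number xy - z is the trace just dropped, and the next step supplies the other
   neighbouring trace; so three consecutive nodes are controlled. *)
have [xb yb zb] := b n.+1 (leqnSn n); have [_ _ /andP[_ zb']] := b n.+2 (leqW (leqnSn n)).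
have [/andP[_ xb0] /andP[_ yb0] _] := b n (leqnn n).
have ub : cnorm (x n.+1 * y n.+1 - z n.+1) <= 2 + e.
  case E: (c n).
    have [-> -> -> _] := stepT _ E.
    by have -> : z n * y n - (z n * y n - x n) = x n by ring.
  have [-> -> -> _] := stepF _ E.
  by have -> : x n * z n - (x n * z n - y n) = y n by ring.
have e01 : 0 < e < 1 by rewrite e0; lra.
suff : d <= 32 * 40 * e by lra.
rewrite /d -(cmu n.+1); case E: (c n.+1).
  have [_ _ Ez _] := stepT _ E.
  have -> : markoff (x n.+1, y n.+1, z n.+1) = markoff (y n.+1, x n.+1, z n.+1).
    by rewrite /=; ring.
  apply: (@near_two_markoff e (y n.+1) (x n.+1) (z n.+1) e01 yb xb zb).
    by rewrite (mulrC (y _)).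
  by rewrite (mulrC (y _)) -Ez.
have [_ _ Ez _] := stepF _ E.
by apply: near_two_markoff => //; rewrite -Ez.
Qed.

End Descent.

Section TreeSummability.
Variable R : realType.
Implicit Types (x y z l m : R[i]) (q : R[i] * R[i] * R[i]) (w : seq bool).
Local Notation step := (@tstep R).
Local Notation node := (foldl step).

(** Each edge entry is a root entry or was the third entry at an earlier node. *)
Lemma node_ind (P : R[i] -> Prop) x y z :
  P x -> P y -> (forall w, P (node (x, y, z) w).2) ->
  forall w, P (node (x, y, z) w).1.1 /\ P (node (x, y, z) w).1.2.
Proof.
move=> Px Py Pz w; elim: w x y z Px Py Pz => //= c w IH x y z Px Py Pz.
have Pz0 : P z := Pz [::].
by case: c; apply: IH => // v; [exact: (Pz (true :: v))|exact: (Pz (false :: v))].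
Qed.

Lemma node_nseq q w c n : node q (w ++ nseq n c) = iter n (step^~ c) (node q w).
Proof.
rewrite foldl_cat; elim: n (node q w) => // n IH p; rewrite [LHS]IH.
exact/esym/iterSr.
Qed.

Lemma iter_swap n q : iter n (step^~ true) q = swap (iter n (step^~ false) (swap q)).
Proof.
elim: n => [|n IH] /=; first by case: q => [[x y] z].
by rewrite IH tstep_swap.
Qed.

Lemma finite_words_size (A : set (seq bool)) : finite_set A ->
  exists n, forall w, (n <= size w)%N -> ~ A w.
Proof.
move=> /finite_seqP[s ->]; exists (\max_(w <- s) size w).+1 => w.
rewrite ltnNge => /negP h ws; apply: h; exact: (@leq_bigmax_seq _ s predT size).
Qed.

Variables (q : R[i] * R[i] * R[i]).
Hypothesis small_fin : finite_set [set w | cnorm (node q w).2 <= 2].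

Lemma small_bound : exists B, forall w, (B <= size w)%N -> 2 < cnorm (node q w).2.
Proof.
have [B BP] := finite_words_size small_fin; exists B => w /BP /= h.
by rewrite ltNge; apply/negP.
Qed.

Lemma no_decay w l : hyperbolic (node q w).1.1 l ->
  (node q w).2 != l * (node q w).1.2.
Proof.
case E: (node q w) => [[x y] z] /= xl; apply/eqP => zly.
have [B BP] := small_bound.
have [k /(_ (maxn k B) (leq_maxl _ _))] := ray_decay xl zly (ltr0Sn _ 1).
rewrite -E -node_nseq leNgt BP // size_cat size_nseq.
by rewrite (leq_trans (leq_maxr k B)) // leq_addl.
Qed.

Lemma no_decay_swap w l : hyperbolic (node q w).1.2 l ->
  (node q w).2 != l * (node q w).1.1.
Proof.
case E: (node q w) => [[x y] z] /= yl; apply/eqP => zlx.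
have [B BP] := small_bound.
have [k /(_ (maxn k B) (leq_maxl _ _))] := ray_decay yl zlx (ltr0Sn _ 1).
have sw (p : R[i] * R[i] * R[i]) : p.2 = (swap p).2 by case: p => [[]].
rewrite sw (_ : (y, x, z) = swap (x, y, z)) // -iter_swap -E -node_nseq.
rewrite leNgt BP // size_cat size_nseq.
by rewrite (leq_trans (leq_maxr k B)) // leq_addl.
Qed.

Hypothesis hyp1 : exists l, hyperbolic q.1.1 l.
Hypothesis hyp2 : exists l, hyperbolic q.1.2 l.
Hypothesis hyp3 : forall w, exists l, hyperbolic (node q w).2 l.
Hypothesis mu4 : markoff q != 4.

Lemma node_hyperbolic w : (exists l, hyperbolic (node q w).1.1 l) /\
  (exists l, hyperbolic (node q w).1.2 l).
Proof.
move: hyp1 hyp2 hyp3; case: q => [[x y] z] h1 h2 h3.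
exact: (@node_ind (fun x => exists l, hyperbolic x l)).
Qed.

Lemma tree_good : good q.
Proof.
apply: contrapT => bad.
(* The path takes the [true] step exactly when the [false] branch is good, so all its nodes stay
   bad. *)
pose d p := `[< good (step p false) >].
pose path n := iter n (fun p => step p (d p)) q.
have path_bad n : ~ good (path n).
  elim: n => // n IH gd; apply: IH.
  have {}gd : good (step (path n) (d (path n))) by [].
  have [g0|g0] := pselect (good (step (path n) false)).
    by apply: good_step => //; move: gd; rewrite /d (asboolT g0).
  by move: gd; rewrite /d (asboolF g0) => /g0.
pose word n := [seq d (path k) | k <- iota 0 n].
have pathE n : path n = node q (word n).
  elim: n => // n IH.
  have -> : word n.+1 = rcons (word n) (d (path n)).
    by rewrite /word -addn1 iotaD map_cat cats1.
  by rewrite foldl_rcons -IH.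
have size_word n : size (word n) = n by rewrite size_map size_iota.
have [B BP] := small_bound.
have zbig n : (B <= n)%N -> 2 < cnorm (path n).2.
  by move=> Bn; rewrite pathE BP // size_word.
have const_dir c n : (forall k, (n <= k)%N -> d (path k) = c) ->
    forall k, path (k + n)%N = iter k (step^~ c) (path n).
  move=> cst; elim=> // k IH; rewrite addSn [path _.+1]/= -/(path _).
  by rewrite cst ?leq_addl // IH.
have turn n b : exists2 k, (n <= k)%N & d (path k) = b.
  apply: contrapT => /forall2NP H.
  have {}H k : (n <= k)%N -> d (path k) = ~~ b.
    by move=> nk; case: (H k) => // /eqP; case: (b); case: (d _).
  have [hx hy] := node_hyperbolic (word n).
  rewrite -pathE in hx hy.
  case: b {H} (const_dir _ _ H) => cst.
    have [l xl] := hx.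
    have := @no_decay (word n) l; rewrite -pathE; case E: (path n) xl => [[x y] z] xl.
    move=> /(_ xl) zl; have [k] := ray_good xl zl.
    by rewrite -E -cst; exact: path_bad.
  have [l yl] := hy.
  have := @no_decay_swap (word n) l; rewrite -pathE; case E: (path n) yl => [[x y] z] yl.
  move=> /(_ yl) zl; have [k kg] := ray_good yl zl.
  apply: (path_bad (k + n)%N); rewrite cst iter_swap.
  by apply: good_swap; rewrite E; case: (iter _ _ _) kg => [[]].
(* After one step of each kind past level [B], both edge entries are traces of curves reached beyond
   that level. *)
have [n0 edge_big] : exists n0, forall n, (n0 <= n)%N ->
    2 < cnorm (path n).1.1 /\ 2 < cnorm (path n).1.2.
  have [n1 Bn1 dn1] := turn B true; have [n2 n12 dn2] := turn n1.+1 false.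
  have stepz n : (B <= n)%N -> (if d (path n) then 2 < cnorm (path n.+1).1.1
      else 2 < cnorm (path n.+1).1.2) /\
      (2 < cnorm (path n).1.1 -> 2 < cnorm (path n.+1).1.1) /\
      (2 < cnorm (path n).1.2 -> 2 < cnorm (path n.+1).1.2).
    move=> /zbig; rewrite [path n.+1]/= -/(path n); move: (path n) => p.
    by case: p => [[x y] z] /= z2; case: (d _).
  have keep1 n k : (B <= n)%N -> 2 < cnorm (path n).1.1 -> 2 < cnorm (path (k + n)%N).1.1.
    move=> Bn h; elim: k => // k IH; rewrite addSn.
    by apply: (stepz (k + n)%N _).2.1 => //; rewrite (leq_trans Bn) // leq_addl.
  have keep2 n k : (B <= n)%N -> 2 < cnorm (path n).1.2 -> 2 < cnorm (path (k + n)%N).1.2.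
    move=> Bn h; elim: k => // k IH; rewrite addSn.
    by apply: (stepz (k + n)%N _).2.2 => //; rewrite (leq_trans Bn) // leq_addl.
  exists n2.+1 => n nn; split.
    have h : 2 < cnorm (path n1.+1).1.1 by have := (stepz n1 Bn1).1; rewrite dn1.
    rewrite -(@subnK n1.+1 n); last by lia.
    by apply: keep1 => //; lia.
  have h : 2 < cnorm (path n2.+1).1.2.
    by have := (stepz n2 ltac:(lia)).1; rewrite dn2.
  by rewrite -(@subnK n2.+1 n) //; apply: keep2 => //; lia.
pose p n := path (n + maxn n0 B)%N.
have E n : p n = ((p n).1.1, (p n).1.2, (p n).2) by case: (p n) => [[]].
have big n : [/\ 2 < cnorm (p n).1.1, 2 < cnorm (p n).1.2 & 2 < cnorm (p n).2].
  have [|h1 h2] := edge_big (n + maxn n0 B)%N; first by lia.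
  by split=> //; apply: zbig; lia.
move/negP: mu4; apply; apply/eqP.
apply: (@descending_markoff R (fun n => (p n).1.1) (fun n => (p n).1.2)
  (fun n => (p n).2) (fun n => d (p n)) (markoff q)) => //.
- by move=> n; rewrite -!E.
- by move=> n; rewrite -E /p pathE markoff_foldl.
- move=> n; rewrite ltNge; apply/negP => out; apply: (path_bad (n + maxn n0 B)%N).
  apply: outward_good; rewrite -/(p n) E /outward out.
  by have [-> -> _] := big n.
- move=> n b; have [k nk dk] := turn (n + maxn n0 B)%N b.
  by exists (k - maxn n0 B)%N; rewrite ?/p ?subnK //; lia.
Qed.

End TreeSummability.

(** * Traces of two-by-two matrices *)

Section HyperbolicTrace.
Variable R : realType.
Implicit Types x : R[i].

Definition half_gap x : R[i] := (1 - sqrtc (1 - 4 / x ^+ 2)) / 2.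

(** With s the square root, x (1 - s)/2 and x (1 + s)/2 have sum x and product 1; the first has the
    smaller modulus as soon as Re s > 0. *)
Lemma hyperbolic_half_gap x : ~~ (-2 <= x <= 2) -> hyperbolic x (x * half_gap x).
Proof.
move=> xI; have x0 : x != 0.
  by apply: contraNneq xI => ->; rewrite oppr_le0 !ler0n.
have := sqr_sqrtc (1 - 4 / x ^+ 2); rewrite /half_gap.
have := Re_sqrtc_ge0 (1 - 4 / x ^+ 2).
case: (sqrtc _) => u v /= u0 sE.
set s := u +i* v in sE *.
have E : x * ((1 - s) / 2) * (x * ((1 + s) / 2)) = 1.
  have -> : x * ((1 - s) / 2) * (x * ((1 + s) / 2)) = x ^+ 2 * (1 - s ^+ 2) / 4 by field.
  by rewrite sE; field.
have l0 : x * ((1 - s) / 2) != 0.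
  by apply: contra_eq_neq E => ->; rewrite mul0r eq_sym oner_neq0.
have lV : (x * ((1 - s) / 2))^-1 = x * ((1 + s) / 2).
  by apply: (mulfI l0); rewrite E divff.
have N (w t : R) : cnorm (w +i* t) ^+ 2 = w ^+ 2 + t ^+ 2.
  by rewrite /cnorm /= sqr_sqrtr // addr_ge0 // sqr_ge0.
have s1 : 1 - s = (1 - u) +i* (- v) by apply/eqP; rewrite eq_complex /= !sub0r !eqxx.
have s2 : 1 + s = (1 + u) +i* v by apply/eqP; rewrite eq_complex /= !add0r !eqxx.
split=> //; last by rewrite lV; field.
(* If Re s = 0 then s^2 = -v^2, so x^2 = 4/(1 + v^2) lies in (0, 4] and x in [-2, 2]. *)
have u1 : 0 < u.
  rewrite lt_def u0 andbT; apply: contraNneq xI => uE.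
  have sr : s ^+ 2 = (- v ^+ 2)%:C.
    by apply/eqP; rewrite /s uE expr2 eq_complex /= !mul0r !mulr0 !addr0 sub0r !eqxx.
  have x2 : x ^+ 2 = (4 / (1 + v ^+ 2))%:C.
    have d0 : 1 + v ^+ 2 != 0 by rewrite gt_eqF // ltr_pwDl // sqr_ge0.
    have : x ^+ 2 * (1 + v ^+ 2)%:C = 4.
      have -> : (1 + v ^+ 2)%:C = 1 - s ^+ 2 by rewrite sr rmorphD rmorphN opprK rmorph1.
      by rewrite sE; field.
    move=> h; rewrite rmorphM rmorph_nat fmorphV /= -h mulfK //.
    by rewrite (inj_eq (@complexI R) _ 0).
  set r := 4 / _ in x2.
  have [r0 r4] : 0 < r /\ r <= 4.
    have v0 := sqr_ge0 v; have d0 : 0 < 1 + v ^+ 2 by lra.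
    by split; [rewrite divr_gt0|rewrite ler_pdivrMr //; lra].
  case: x x0 x2 {E l0 lV sE} => p q x0 /eqP; rewrite expr2 eq_complex /=.
  move=> /andP[/eqP h1 /eqP h2].
  have q0 : q = 0.
    have /eqP : p * q = 0 by lra.
    rewrite mulf_eq0 => /orP[/eqP p0|/eqP//]; move: h1; rewrite p0; nra.
  rewrite q0 in h1 *; have -> : p +i* 0 = p%:C by [].
  have -> : (2 : R[i]) = (2 : R)%:C by rewrite rmorph_nat.
  rewrite -rmorphN !lecR.
  by apply/andP; split; nra.
have : cnorm (x * ((1 - s) / 2)) < cnorm (x * ((1 + s) / 2)).
  rewrite !cnormM ltr_pM2l ?cnorm_gt0 // ltr_pM2r ?cnorm_gt0 ?invr_eq0 ?pnatr_eq0 //.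
  rewrite -ltr_sqr ?nnegrE ?cnorm_ge0 // s1 s2 !N; nra.
have : cnorm (x * ((1 - s) / 2)) * cnorm (x * ((1 + s) / 2)) = 1.
  by rewrite -cnormM E (cnorm_nat _ 1).
have := cnorm_ge0 (x * ((1 - s) / 2)).
by move: (cnorm _) (cnorm _) => c d *; nra.
Qed.

End HyperbolicTrace.

Section TwoByTwo.
Variable K : fieldType.
Implicit Types A B M N : 'M[K]_2.

Lemma ord2P (k : 'I_2) : k = 0 \/ k = 1.
Proof. by case: k => -[|[|//]] ?; [left|right]; apply/val_inj. Qed.

Lemma mx2P A B : A 0 0 = B 0 0 -> A 0 1 = B 0 1 -> A 1 0 = B 1 0 -> A 1 1 = B 1 1 ->
  A = B.
Proof.
move=> h1 h2 h3 h4; apply/matrixP => p q.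
by case: (ord2P p) => ->; case: (ord2P q) => ->.
Qed.

Lemma mulmx2E A B p q : (A *m B) p q = A p 0 * B 0 q + A p 1 * B 1 q.
Proof.
rewrite mxE !big_ord_recl big_ord0 addr0.
by have -> : lift ord0 ord0 = 1 :> 'I_2 by apply/val_inj.
Qed.

Lemma mxtrace2E A : \tr A = A 0 0 + A 1 1.
Proof.
rewrite /mxtrace !big_ord_recl big_ord0 addr0.
by have -> : lift ord0 ord0 = 1 :> 'I_2 by apply/val_inj.
Qed.

(** The adjugate, in the form given by Cayley and Hamilton, which makes its trace identities
    linear. *)
Definition adj2 A : 'M[K]_2 := (\tr A)%:M - A.

Lemma adj2E A : [/\ adj2 A 0 0 = A 1 1, adj2 A 0 1 = - A 0 1,
  adj2 A 1 0 = - A 1 0 & adj2 A 1 1 = A 0 0].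
Proof.
rewrite /adj2 !mxE mxtrace2E /= !mulr1n !mulr0n !sub0r.
by split=> //; ring.
Qed.

Lemma addmx2E A B p q : (A + B) p q = A p q + B p q. Proof. by rewrite mxE. Qed.
Lemma oppmx2E A p q : (- A) p q = - A p q. Proof. by rewrite mxE. Qed.
Lemma scalemx2E (c : K) A p q : (c *: A) p q = c * A p q. Proof. by rewrite mxE. Qed.
Lemma scalar_mx2E (c : K) : [/\ (c%:M : 'M[K]_2) 0 0 = c, (c%:M : 'M[K]_2) 0 1 = 0,
  (c%:M : 'M[K]_2) 1 0 = 0 & (c%:M : 'M[K]_2) 1 1 = c].
Proof. by rewrite !mxE. Qed.

Lemma det2E A : \det A = A 0 0 * A 1 1 - A 0 1 * A 1 0.
Proof.
rewrite (expand_det_row _ 0) !big_ord_recl big_ord0 addr0.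
have -> : lift ord0 ord0 = 1 :> 'I_2 by apply/val_inj.
rewrite /cofactor !det_mx11 !mxE /= expr0 expr1 mul1r mulN1r mulrN.
by congr (_ * A _ _ - _ * A _ _); apply/val_inj.
Qed.

Definition mx2E := (mxtrace2E, det2E, mulmx2E, addmx2E, oppmx2E, scalemx2E).

Lemma mul_adj2 A : A *m adj2 A = (\det A)%:M.
Proof.
have [a1 a2 a3 a4] := adj2E A; have [c1 c2 c3 c4] := scalar_mx2E (\det A).
by apply: mx2P; rewrite ?(c1, c2, c3, c4) mulmx2E ?(a1, a2, a3, a4) ?mx2E; ring.
Qed.

Lemma trace_adj2_mul A B : \tr (adj2 A *m B) = \tr A * \tr B - \tr (A *m B).
Proof. by rewrite /adj2 mulmxBl mul_scalar_mx raddfB /= mxtraceZ. Qed.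

Lemma trace_mul2 A B : \tr (A *m (A *m B)) = \tr A * \tr (A *m B) - \det A * \tr B.
Proof. by rewrite !mx2E; ring. Qed.

Lemma trace_commutator2 A B :
  \tr (A *m B *m adj2 A *m adj2 B) =
  \tr A ^+ 2 * \det B + \tr B ^+ 2 * \det A + \tr (A *m B) ^+ 2
  - \tr A * \tr B * \tr (A *m B) - 2 * \det A * \det B.
Proof.
have [a1 a2 a3 a4] := adj2E A; have [b1 b2 b3 b4] := adj2E B.
by rewrite [LHS]mxtrace2E !mulmx2E a1 a2 a3 a4 b1 b2 b3 b4 !mx2E; ring.
Qed.

(** By [trace_commutator2] the right side is 4 - mu, so mu = 4 exactly when AB - BA is singular. *)
Lemma det_commutator2 A B : \det A = 1 -> \det B = 1 ->
  \det (A *m B - B *m A) = 4 - (\tr A ^+ 2 + \tr B ^+ 2 + \tr (A *m B) ^+ 2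
  - \tr A * \tr B * \tr (A *m B)).
Proof.
move=> dA dB.
have -> : \det (A *m B - B *m A) = 4 * \det A * \det B - (\tr A ^+ 2 * \det B +
    \tr B ^+ 2 * \det A + \tr (A *m B) ^+ 2 - \tr A * \tr B * \tr (A *m B)).
  by rewrite !mx2E; ring.
by rewrite dA dB !mulr1.
Qed.

Lemma mul_comm_mul A B : let C := A *m B - B *m A in
  C *m A *m C = - \det C *: adj2 A.
Proof.
have [a1 a2 a3 a4] := adj2E A.
by apply: mx2P; rewrite scalemx2E ?(a1, a2, a3, a4) ?mx2E; ring.
Qed.

Lemma comm_sqr A B : let C := A *m B - B *m A in C *m C = (- \det C)%:M.
Proof.
move=> C; have [c1 c2 c3 c4] := scalar_mx2E (- \det C).
by apply: mx2P; rewrite ?(c1, c2, c3, c4) /C !mx2E; ring.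
Qed.

(* A singular commutator C <> 0 of A and B satisfies C^2 = C A C = 0, so its row
   space is the kernel of C and contains the rows of C A. *)
Lemma comm_stable A B : let C := A *m B - B *m A in
  \det C = 0 -> C != 0 -> stablemx C A.
Proof.
move=> C dC C0.
have CC : C *m C = 0.
  by rewrite comm_sqr dC oppr0; apply/matrixP => p q; rewrite !mxE mul0rn.
have CAC : C *m A *m C = 0 by rewrite mul_comm_mul dC oppr0 scale0r.
have rC : \rank C = 1%N.
  have : (\rank C < 2)%N.
    rewrite ltn_neqAle rank_leq_row andbT; apply/negP => h.
    have : row_full C by rewrite /row_full (eqP h).
    by rewrite row_full_unit unitmxE dC unitr0.
  by have : (0 < \rank C)%N by [rewrite lt0n mxrank_eq0]; case: (\rank C) => [|[|]].
have sub : (C <= kermx C)%MS by apply/sub_kermxP.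
have ker : (C == kermx C)%MS.
  by rewrite -(mxrank_leqif_eq sub).2 mxrank_ker rC.
by rewrite (eqmxP ker); apply/sub_kermxP.
Qed.

End TwoByTwo.

(** * Traces of a representation along the Farey tree *)

Section Representation.
Variables (R : realType) (F : groupType) (rho : F -> 'M[R[i]]_2).
Hypothesis rhoP : SL2_representation rho.
Implicit Types g h t : F.

Let rhoM g h : rho (g * h)%g = rho g *m rho h. Proof. exact: rhoP.1. Qed.
Let rho_det g : \det (rho g) = 1. Proof. exact: rhoP.2. Qed.

Lemma rep_unit g : rho g \in unitmx.
Proof. by rewrite unitmxE rho_det unitr1. Qed.

Lemma rep1 : rho 1%g = 1%:M.
Proof. by rewrite -[LHS](mulKmx (rep_unit 1%g)) -rhoM mulg1 mulVmx ?rep_unit. Qed.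

Lemma repV g : rho g^-1%g = adj2 (rho g).
Proof.
by rewrite -[LHS](mulKmx (rep_unit g)) -rhoM mulgV rep1 -(rho_det g) -mul_adj2
  mulKmx ?rep_unit.
Qed.

Lemma trace_repV g : \tr (rho g^-1%g) = \tr (rho g).
Proof. by have := trace_adj2_mul (rho g) 1%:M; rewrite !mulmx1 -repV mxtrace1 => ->; ring. Qed.

Lemma trace_repJ g t : \tr (rho (g ^ t)%g) = \tr (rho g).
Proof. by rewrite conjgE rhoM mxtrace_mulC -rhoM mulgK. Qed.

Definition trace_triple (p : F * F) : R[i] * R[i] * R[i] :=
  (\tr (rho p.1), \tr (rho p.2), \tr (rho (p.1 * p.2)%g)).

Lemma trace_triple_step p c : trace_triple (gstep p c) = tstep (trace_triple p) c.
Proof.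
rewrite /trace_triple; case: c => /=; rewrite !rhoM; congr (_, _, _).
  rewrite -mulmxA mxtrace_mulC -mulmxA trace_mul2 rho_det mul1r.
  by rewrite (mxtrace_mulC (rho p.2)) mulrC.
by rewrite trace_mul2 rho_det mul1r.
Qed.

Lemma trace_triple_node p w :
  trace_triple (foldl (@gstep F) p w) = foldl (@tstep R) (trace_triple p) w.
Proof. by elim: w p => //= c w IH p; rewrite IH trace_triple_step. Qed.

Lemma markoff_trace_triple g h :
  markoff (trace_triple (g, h)) = peripheral_trace g h rho + 2.
Proof.
rewrite /peripheral_trace !rhoM !repV trace_commutator2 !rho_det /= rhoM.
by ring.
Qed.

Lemma curve_traceE g : curve_trace rho (unoriented_class g) = \tr (rho g).
Proof.
rewrite /curve_trace; case: xgetP => [x _ [t [->|->]]|/(_ g) []].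
- exact: trace_repJ.
- by rewrite trace_repJ trace_repV.
- by exists 1%g; left; rewrite conjg1.
Qed.

Variables (a b : F).
Hypotheses (hab : free_basis a b) (rho_irr : irreducible_representation rho).

Lemma stable_rep (U : 'M[R[i]]_2) : stablemx U (rho a) -> stablemx U (rho b) ->
  forall g, stablemx U (rho g).
Proof.
move=> Ua Ub; pose P g := stablemx U (rho g).
refine (@free_basis_ind F a b P hab Ua Ub _ _ _); rewrite /P.
- by rewrite rep1 mulmx1.
- by move=> x y Ux Uy; rewrite rhoM stablemxM.
- by move=> x Ux; rewrite repV /adj2 stablemxD // ?stablemxN // stablemxC.
Qed.

Lemma singular_not_stable (U : 'M[R[i]]_2) : \det U = 0 -> U != 0 ->
  stablemx U (rho a) -> stablemx U (rho b) -> False.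
Proof.
move=> dU U0 Ua Ub; have := rho_irr (stable_rep Ua Ub) U0.
by rewrite row_full_unit unitmxE dU unitr0.
Qed.

(** The value 4 makes AB - BA singular. If it is nonzero, its row space is an invariant line. If it
    is zero, A - l and B - m commute with A and B, and either one, if nonzero, has an invariant row
    space; if both vanish, A and B are scalar and any line will do. *)
Lemma irreducible_markoff l : \det (rho a - l%:M) = 0 ->
  forall m, \det (rho b - m%:M) = 0 ->
  markoff (trace_triple (a, b)) != 4.
Proof.
move=> dl m dm; apply/eqP => mu4.
pose C := rho a *m rho b - rho b *m rho a.
have dC : \det C = 0.
  rewrite /C det_commutator2 ?rho_det //; move: mu4; rewrite /trace_triple /= rhoM => <-.
  by ring.
have [C0|C0] := eqVneq C 0; last first.
  apply: (singular_not_stable dC C0); first exact: comm_stable.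
  pose C' := rho b *m rho a - rho a *m rho b.
  have CN : C' = - C by rewrite opprB.
  have dC' : \det C' = 0 by rewrite CN -dC !det2E !oppmx2E; ring.
  have C'0 : C' != 0 by rewrite CN oppr_eq0.
  by rewrite -stableNmx -CN; exact: comm_stable.
have comm : comm_mx (rho a) (rho b) by apply/eqP; rewrite -subr_eq0; exact/eqP.
have [Ua|Ua] := eqVneq (rho a - l%:M) 0; last first.
  apply: (singular_not_stable dl Ua).
    by apply: comm_mx_stable; apply/comm_mx_sym/comm_mxB => //; exact: comm_mx_scalar.
  apply: comm_mx_stable; apply/comm_mx_sym/comm_mxB; first exact/comm_mx_sym.
  exact: comm_mx_scalar.
have [Ub|Ub] := eqVneq (rho b - m%:M) 0; last first.
  apply: (singular_not_stable dm Ub).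
    by apply: comm_mx_stable; apply/comm_mx_sym/comm_mxB => //; exact: comm_mx_scalar.
  apply: comm_mx_stable; apply/comm_mx_sym/comm_mxB; first exact: comm_mx_refl.
  exact: comm_mx_scalar.
pose U : 'M[R[i]]_2 := delta_mx 0 0.
have aE : rho a = l%:M by apply/eqP; rewrite -subr_eq0 Ua.
have bE : rho b = m%:M by apply/eqP; rewrite -subr_eq0 Ub.
apply: (@singular_not_stable U); rewrite ?aE ?bE ?stablemxC //.
  by rewrite det2E !mxE /= mulr0 mul0r subr0.
by apply/eqP => /matrixP /(_ 0 0) /eqP; rewrite !mxE /= oner_eq0.
Qed.

Lemma det_sub_scalar (A : 'M[R[i]]_2) l : \det A = 1 -> hyperbolic (\tr A) l ->
  \det (A - l%:M) = 0.
Proof.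
move=> dA [l0 _ trE]; have [c1 c2 c3 c4] := scalar_mx2E l.
have -> : \det (A - l%:M) = \det A - l * \tr A + l ^+ 2.
  by rewrite !det2E !addmx2E !oppmx2E c1 c2 c3 c4 !mx2E; ring.
by rewrite dA trE; field.
Qed.

End Representation.

(** * Telescoping over the edges *)

Section EdgeFunction.
Variable R : realType.
Variable mu : R[i].
Implicit Types x y z p l : R[i].
Local Notation hg := (@half_gap R).

(* The sum of h over all curves on the far side of the edge {x, y}, where z is
   the next curve on that side. *)
Definition edge_fun x y z p p' : R[i] :=
  let E := (x * y - z) / (x * y) in
  (E - hg x - hg y + p * mu / (x ^+ 2 - mu) * (E - hg x)
    + p' * mu / (y ^+ 2 - mu) * (E - hg y)) / 2.

Lemma h_fun_half_gap p x : x ^+ 2 != mu ->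
  h_fun mu p x = hg x - p * mu * (1 - 2 * hg x) / (2 * (x ^+ 2 - mu)).
Proof.
move=> xmu; rewrite /h_fun /half_gap; set s := sqrtc _.
by field; rewrite subr_eq0.
Qed.

(** All half gaps cancel; the rational remainder reduces through the Markoff equation to (p + p' +
    p'' - 1) m / 2 with m = mu/(xyz). *)
Lemma edge_fun_step x y z p p' p'' :
  x != 0 -> y != 0 -> z != 0 -> x ^+ 2 != mu -> y ^+ 2 != mu -> z ^+ 2 != mu ->
  markoff (x, y, z) = mu -> p + p' + p'' = 1 ->
  edge_fun x y z p p' = h_fun mu p'' z +
    (edge_fun x z (x * z - y) p p'' + edge_fun z y (z * y - x) p'' p').
Proof.
move=> x0 y0 z0 xmu ymu zmu muE p1; rewrite h_fun_half_gap // /edge_fun.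
move: (hg x) (hg y) (hg z) => kx ky kz.
have p1' : p'' = 1 - p - p' by rewrite -p1; ring.
rewrite -subr_eq0 in xmu; rewrite -subr_eq0 in ymu; rewrite -subr_eq0 in zmu.
have -> : (x * z - (x * z - y)) / (x * z) = y / (x * z) by congr (_ / _); ring.
have -> : (z * y - (z * y - x)) / (z * y) = x / (z * y) by congr (_ / _); ring.
set E := (x * y - z) / (x * y); set a := y / (x * z); set b := x / (z * y).
pose m := mu / (x * y * z).
have hE : E - a - b = - m.
  by rewrite /E /a /b /m -muE /markoff; field; rewrite x0 y0 z0.
have hx : mu / (x ^+ 2 - mu) * (E - a) = m.
  have -> : E - a = (x ^+ 2 - mu) / (x * y * z).
    by rewrite /E /a -muE /markoff; field; rewrite x0 y0 z0.
  by rewrite /m; field; rewrite x0 y0 z0 xmu.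
have hy : mu / (y ^+ 2 - mu) * (E - b) = m.
  have -> : E - b = (y ^+ 2 - mu) / (x * y * z).
    by rewrite /E /b -muE /markoff; field; rewrite x0 y0 z0.
  by rewrite /m; field; rewrite x0 y0 z0 ymu.
have hz : mu / (z ^+ 2 - mu) * (1 - a - b) = m.
  have -> : 1 - a - b = (z ^+ 2 - mu) / (x * y * z).
    by rewrite /a /b -muE /markoff; field; rewrite x0 y0 z0.
  by rewrite /m; field; rewrite x0 y0 z0 zmu.
have -> : p'' * mu * (1 - 2 * kz) / (2 * (z ^+ 2 - mu)) =
    p'' * (mu / (z ^+ 2 - mu)) * (1 - 2 * kz) / 2 by field.
rewrite -!(mulrA _ mu); move: (mu / (x ^+ 2 - mu)) (mu / (y ^+ 2 - mu)) (mu / (z ^+ 2 - mu)) hx hy hz.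
move=> X Y Z hx hy hz.
apply/eqP; rewrite -subr_eq0; apply/eqP.
transitivity ((E - a - b + p * (X * (E - a)) + p' * (Y * (E - b))
  + p'' * (Z * (1 - a - b))) / 2); first by field.
by rewrite hE hx hy hz p1'; ring.
Qed.

(** Replacing z by xy - z turns E into 1 - E, so the two sides together cancel the half gaps in
    [h_fun]. *)
Lemma edge_fun_root x y z p p' : x != 0 -> y != 0 -> x ^+ 2 != mu -> y ^+ 2 != mu ->
  h_fun mu p x + h_fun mu p' y + edge_fun x y z p p' + edge_fun x y (x * y - z) p p' = 1 / 2.
Proof.
move=> x0 y0 xmu ymu; rewrite !h_fun_half_gap // /edge_fun.
move: (hg x) (hg y) => kx ky; rewrite -subr_eq0 in xmu; rewrite -subr_eq0 in ymu.
have -> : (x * y - (x * y - z)) / (x * y) = 1 - (x * y - z) / (x * y).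
  by field; rewrite x0 y0.
have hE q u k : u != 0 -> q * mu * (1 - 2 * k) / (2 * u) = q * mu / u * (1 - 2 * k) / 2.
  by move=> u0; field.
rewrite !hE //; move: (_ / (x * y)) (p * mu / _) (p' * mu / _) => E X Y.
by field.
Qed.

(** As x = l + 1/l, the polynomial z^2 - xyz + y^2 factors as (z - l y)(z - y/l), and the Markoff
    equation equates it to mu - x^2; here xy - z - l y = y/l - z. *)
Lemma tail_gap x y z l : hyperbolic x l -> l = x * hg x -> x != 0 -> y != 0 ->
  z - l * y != 0 -> markoff (x, y, z) = mu ->
  (x * y - z) / (x * y) - hg x = (x ^+ 2 - mu) / (x * y * (z - l * y)).
Proof.
move=> [l0 _ xE] lE x0 y0 zl muE.
have -> : hg x = l / x by rewrite lE mulrC mulKf.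
apply: (mulIf zl); apply: (mulIf x0); apply: (mulIf y0).
have -> : (x ^+ 2 - mu) / (x * y * (z - l * y)) * (z - l * y) * x * y = x ^+ 2 - mu.
  by field; rewrite x0 y0 zl.
have -> : ((x * y - z) / (x * y) - l / x) * (z - l * y) * x * y =
    (x * y - z - l * y) * (z - l * y) by field; rewrite x0 y0.
have lx : l * x = l ^+ 2 + 1 by rewrite xE; field.
rewrite -muE /markoff.
have -> : (x * y - z - l * y) * (z - l * y) =
  x * y * z - z ^+ 2 - y ^+ 2 * (l * x - l ^+ 2) by ring.
by rewrite lx; ring.
Qed.

(** The half gap is l/x, and |x||l| <= |l|^2 + 1 <= 2. *)
Lemma gap_bound x l : hyperbolic x l -> l = x * hg x -> cnorm (hg x) <= 2 / cnorm x ^+ 2.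
Proof.
move=> [l0 l1 xE] lE.
have c0 : 0 < cnorm l by rewrite cnorm_gt0.
have x0 : x != 0 by apply: contraNneq l0 => x0; rewrite lE x0 mul0r.
have cx : 0 < cnorm x by rewrite cnorm_gt0.
have -> : hg x = l / x by rewrite lE mulrC mulKf.
rewrite cnormM cnormV.
have : cnorm x <= cnorm l + (cnorm l)^-1 by rewrite {1}xE -cnormV cnormD.
have v0 : 0 < (cnorm l)^-1 by rewrite invr_gt0.
have lv : cnorm l * (cnorm l)^-1 = 1 by rewrite divff // gt_eqF.
have h : 1 < (cnorm l)^-1 by rewrite invf_gt1.
move=> xl; have : cnorm x * cnorm l <= 2 by nra.
move=> xl2; rewrite expr2 invfM mulrA ler_pM2r ?invr_gt0 // ler_pdivlMr //.
by rewrite mulrC.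
Qed.

End EdgeFunction.

Section Bounds.
Variable R : realType.
Variable mu : R[i].
Implicit Types x y z p l : R[i].
Local Notation hg := (@half_gap R).

(** [tail_gap] cancels the denominators x^2 - mu and y^2 - mu; in their place stands |z - l y|, at
    least (1 - r)|z| because |y| <= |z| and |l| <= r, and likewise with x. *)
Lemma edge_fun_bound x y z p p' lx ly (r d P : R) :
  hyperbolic x lx -> lx = x * hg x -> hyperbolic y ly -> ly = y * hg y ->
  x ^+ 2 != mu -> y ^+ 2 != mu ->
  cnorm lx <= r -> cnorm ly <= r -> r < 1 -> 0 < d -> d <= cnorm z ->
  cnorm p <= P -> cnorm p' <= P -> markoff (x, y, z) = mu -> admissible (x, y, z) ->
  cnorm (edge_fun mu x y z p p') <=
    ((2 + cnorm mu / d) / (1 - r) + 2 + 2 * (P * cnorm mu / ((1 - r) * d))) / cnorm (x * y).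
Proof.
move=> hx lxE hy lyE xmu ymu lxr lyr r1 d0 dz pP pP' muE /and3P[xz yz xyz].
have [lx0 _ _] := hx; have [ly0 _ _] := hy.
have x0 : x != 0 by apply: contraNneq lx0 => x0; rewrite lxE x0 mul0r.
have y0 : y != 0 by apply: contraNneq ly0 => y0; rewrite lyE y0 mul0r.
have cx : 0 < cnorm x by rewrite cnorm_gt0.
have cy : 0 < cnorm y by rewrite cnorm_gt0.
have cz : 0 < cnorm z by exact: lt_le_trans dz.
have r0 : 0 < 1 - r by lra.
have m0 := cnorm_ge0 mu.
have cxy : 0 < cnorm (x * y) by rewrite cnormM mulr_gt0.
have far u l : cnorm l <= r -> cnorm u <= cnorm z -> (1 - r) * cnorm z <= cnorm (z - l * u).
  move=> lr uz; have := cnorm_lebB z (l * u); rewrite cnormM.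
  have l0 := cnorm_ge0 l; have u0 := cnorm_ge0 u.
  have : cnorm l * cnorm u <= r * cnorm z by apply: ler_pM.
  by lra.
have fx := far _ _ lxr yz; have fy := far _ _ lyr xz.
have pos : 0 < (1 - r) * cnorm z by exact: mulr_gt0.
have zx : z - lx * y != 0 by rewrite -cnorm_gt0; exact: lt_le_trans fx.
have zy : z - ly * x != 0 by rewrite -cnorm_gt0; exact: lt_le_trans fy.
have Gx := tail_gap hx lxE x0 y0 zx muE.
have muE' : markoff (y, x, z) = mu by rewrite -muE /markoff; ring.
have := tail_gap hy lyE y0 x0 zy muE'; rewrite (mulrC y x) => Gy.
pose g := (2 + cnorm mu / d) / (1 - r).
pose t := P * cnorm mu / ((1 - r) * d).
have tail u l q : u ^+ 2 != mu -> z - l != 0 -> (1 - r) * cnorm z <= cnorm (z - l) ->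
    cnorm q <= P ->
    cnorm (q * mu / (u ^+ 2 - mu) * ((u ^+ 2 - mu) / (x * y * (z - l)))) <= t / cnorm (x * y).
  move=> umu zl fl qP; rewrite -subr_eq0 in umu.
  have -> : q * mu / (u ^+ 2 - mu) * ((u ^+ 2 - mu) / (x * y * (z - l))) =
    q * mu / (z - l) / (x * y) by field; rewrite x0 y0 zl umu.
  rewrite 2!cnormM (cnormM q) !cnormV ler_pM2r ?invr_gt0 // /t.
  have q0 := cnorm_ge0 q.
  apply: ler_pM; rewrite ?mulr_ge0 ?invr_ge0 ?cnorm_ge0 //; first by rewrite ler_wpM2r.
  rewrite lef_pV2 ?posrE ?mulr_gt0 //; last exact: lt_le_trans fl.
  by apply: le_trans fl; rewrite ler_pM2l.
(* Here [u] is the entry of smaller modulus: |u|^2 <= |xy| <= 2|z| controls the first term, and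
   2/|v|^2 <= 2/|xy| the second. *)
have main u v l : cnorm u <= cnorm v -> cnorm u * cnorm v = cnorm (x * y) ->
    z - l != 0 -> (1 - r) * cnorm z <= cnorm (z - l) -> cnorm (hg v) <= 2 / cnorm v ^+ 2 ->
    0 < cnorm u ->
    cnorm ((u ^+ 2 - mu) / (x * y * (z - l)) - hg v) <= (g + 2) / cnorm (x * y).
  move=> uv uvE zl fl hv u0; apply: le_trans (cnormB _ _) _; rewrite [leRHS]mulrDl lerD //.
    have -> : (u ^+ 2 - mu) / (x * y * (z - l)) = (u ^+ 2 - mu) / (z - l) / (x * y).
      by field; rewrite x0 y0 zl.
    rewrite cnormM (cnormV (x * y)) ler_pM2r ?invr_gt0 // cnormM cnormV.
    apply: (@le_trans _ _ ((cnorm u ^+ 2 + cnorm mu) / ((1 - r) * cnorm z))).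
      apply: ler_pM; rewrite ?invr_ge0 ?cnorm_ge0 //.
        by rewrite -cnormX; exact: cnormB.
      by rewrite lef_pV2 ?posrE //; exact: lt_le_trans fl.
    rewrite invfM mulrCA (mulrC (1 - r)^-1) ler_pM2r ?invr_gt0 // mulrDl lerD //.
      rewrite ler_pdivrMr //; apply: le_trans xyz; rewrite -uvE expr2.
      by rewrite ler_pM2l.
    by rewrite ler_wpM2l // lef_pV2 ?posrE.
  apply: le_trans hv _; rewrite ler_pM2l // lef_pV2 ?posrE ?exprn_gt0 //;
    last exact: lt_le_trans uv.
  by rewrite -uvE expr2 ler_pM2r //; exact: lt_le_trans uv.
have gx := gap_bound hx lxE; have gy := gap_bound hy lyE.
have M : cnorm ((x * y - z) / (x * y) - hg x - hg y) <= (g + 2) / cnorm (x * y).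
  have [xy|/ltW yx] := leP (cnorm x) (cnorm y).
    by rewrite Gx; apply: main => //; rewrite cnormM.
  by rewrite addrAC Gy; apply: main => //; rewrite cnormM mulrC.
have T1 := tail x (lx * y) p xmu zx fx pP.
have T2 := tail y (ly * x) p' ymu zy fy pP'.
rewrite -Gx in T1; rewrite -Gy in T2; rewrite /edge_fun.
set A := _ - hg x - hg y in M *; move: T1 T2.
set B := _ * (_ - hg x); set D := _ * (_ - hg y) => T1 T2.
rewrite cnormM cnormV cnorm_nat.
have h1 := cnormD (A + B) D; have h2 := cnormD A B.
have h0 := cnorm_ge0 (A + B + D).
have -> : (g + 2 + 2 * t) / cnorm (x * y) = (g + 2) / cnorm (x * y)
  + t / cnorm (x * y) + t / cnorm (x * y) by ring.
by lra.
Qed.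

(** The threshold makes |x^2 - mu| >= |x|/2, and a half gap of modulus at most 2 gives the factor
    5. *)
Lemma h_fun_bound x l p (P : R) : hyperbolic x l -> l = x * hg x ->
  1 + 2 * cnorm mu <= cnorm x -> cnorm p <= P ->
  cnorm (h_fun mu p x) <= (2 + 5 * (P * cnorm mu)) / cnorm x.
Proof.
move=> hx lE big pP; have m0 := cnorm_ge0 mu.
have x1 : 1 <= cnorm x by lra.
have p0 := cnorm_ge0 p.
have x2 : cnorm x <= cnorm x ^+ 2 by rewrite expr2; nra.
have far : cnorm x / 2 <= cnorm (x ^+ 2 - mu).
  have := cnorm_lebB (x ^+ 2) mu; rewrite cnormX; nra.
have xmu : x ^+ 2 != mu.
  by rewrite -subr_eq0 -cnorm_gt0; lra.
rewrite h_fun_half_gap //; have gx := gap_bound hx lE.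
have gx1 : cnorm (hg x) <= 2 / cnorm x.
  apply: le_trans gx _; rewrite ler_pM2l // lef_pV2 ?posrE ?exprn_gt0 //; lra.
have gx2 : cnorm (hg x) <= 2.
  by apply: le_trans gx1 _; rewrite ler_pdivrMr; lra.
apply: le_trans (cnormB _ _) _; rewrite [leRHS]mulrDl lerD //.
rewrite cnormM cnormV (cnormM 2) cnorm_nat 2!cnormM.
have h : cnorm (1 - 2 * hg x) <= 5.
  apply: le_trans (cnormB _ _) _; rewrite cnormM !cnorm_nat (cnorm_nat _ 1); lra.
have h0 := cnorm_ge0 (1 - 2 * hg x).
apply: (@le_trans _ _ (P * cnorm mu * 5 / cnorm x)); last by rewrite (mulrC _ 5).
apply: ler_pM; rewrite ?mulr_ge0 ?invr_ge0 ?mulr_ge0 ?cnorm_ge0 //.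
  by apply: ler_pM => //; rewrite ?mulr_ge0 // ler_wpM2r.
rewrite lef_pV2 ?posrE ?mulr_gt0 //; lra.
Qed.

End Bounds.

Lemma bounded_words (R : realType) (n : nat) (f : seq bool -> R) (C : R) :
  (forall w, (n <= size w)%N -> f w <= C) -> exists D, forall w, f w <= D.
Proof.
elim: n f => [|n IH] f fC; first by exists C => w; exact: fC.
have [|D0 D0P] := IH (fun w => f (false :: w)); first by move=> w ?; exact: fC.
have [|D1 D1P] := IH (fun w => f (true :: w)); first by move=> w ?; exact: fC.
exists (Num.max (f [::]) (Num.max D0 D1)) => -[|[] w]; rewrite !le_max ?lexx //.
  by rewrite D1P !orbT.
by rewrite D0P !orbT.
Qed.

Section TreeLimits.
Variables (R : realType) (S : Type) (step : S -> bool -> S).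

Lemma level_sum_ge (f : S -> R) (q : S) w : (forall q, 0 <= f q) ->
  f (foldl step q w) <= level_sum step f (size w) q.
Proof.
move=> f0; have l0 n p : 0 <= level_sum step f n p.
  by elim: n p => [|n IH] p //=; rewrite addr_ge0.
elim: w q => [|c w IH] q //=; apply: le_trans (IH _) _.
by case: c; rewrite ?lerDl ?lerDr.
Qed.

Lemma level_sum_to0 (f : S -> R) (q : S) (C e : R) : (forall q, 0 <= f q) ->
  (forall n, tree_sum step f n q <= C) -> 0 < e ->
  exists B, forall n, (B <= n)%N -> level_sum step f n q < e.
Proof.
move=> f0 fC e0; pose u n := level_sum step f n q.
have u0 n : 0 <= u n.
  by rewrite /u; elim: n q {fC u} => [|n IH] p //=; rewrite addr_ge0.
have cv : cvgn (series u).
  apply: nondecreasing_is_cvgn; first by apply: nondecreasing_series => n _ _.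
  exists C => _ [n _ <-]; apply: le_trans (fC n).
  by rewrite tree_sum_level /series /= big_mkord.
have /cvgrPdist_lt /(_ e e0) [B _ BP] := cvg_series_cvg_0 cv.
by exists B => n /BP /=; rewrite sub0r normrN; exact: le_lt_trans (ler_norm _).
Qed.

Lemma cnorm_level_sum (f : S -> R[i]) n q :
  cnorm (level_sum step f n q) <= level_sum step (fun q => cnorm (f q)) n q.
Proof.
elim: n q => [|n IH] q //=; apply: le_trans (cnormD _ _) _; exact: lerD.
Qed.

Lemma le_level_sum (f g : S -> R) n q :
  (forall w, f (foldl step q w) <= g (foldl step q w)) ->
  level_sum step f n q <= level_sum step g n q.
Proof.
elim: n q => [|n IH] q fg /=; first exact: (fg [::]).
by apply: lerD; apply: IH => w; [exact: (fg (false :: w))|exact: (fg (true :: w))].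
Qed.

Lemma tree_sum_telescope (V : zmodType) (h e : S -> V) n q :
  (forall w, let p := foldl step q w in
    e p = h p + (e (step p false) + e (step p true))) ->
  tree_sum step h n q = e q - level_sum step e n q.
Proof.
elim: n q => [|n IH] q he /=; first by rewrite subrr.
rewrite (IH _ (fun w => he (false :: w))) (IH _ (fun w => he (true :: w))).
have /= -> := he [::].
by rewrite addrACA -opprD addrA.
Qed.

End TreeLimits.

Lemma tree_sum_map (S T : Type) (V : zmodType) (sS : S -> bool -> S)
    (sT : T -> bool -> T) (k : S -> T) (f : T -> V) n q :
  (forall q c, k (sS q c) = sT (k q) c) ->
  tree_sum sS (fun q => f (k q)) n q = tree_sum sT f n (k q).
Proof. by move=> kS; elim: n q => [|n IH] q //=; rewrite !IH !kS. Qed.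

(** * Telescoping over one side of the root edge, with colours *)

Section ColouredTree.
Variable R : realType.
Variables (mu : R[i]) (pc : bool * bool -> R[i]).
Local Notation hg := (@half_gap R).
Local Notation colours := ((bool * bool) * (bool * bool))%type.
Local Notation state := ((R[i] * R[i] * R[i]) * colours)%type.

Definition cstep (s : state) (c : bool) : state := (tstep s.1 c, hstep s.2 c).

Definition colour3 (s : state) := addb2 s.2.1 s.2.2.

Definition node_term (s : state) : R[i] := h_fun mu (pc (colour3 s)) s.1.2.

Definition edge_term (s : state) : R[i] :=
  edge_fun mu s.1.1.1 s.1.1.2 s.1.2 (pc s.2.1) (pc s.2.2).

Lemma foldl_cstep q u w :
  foldl cstep (q, u) w = (foldl (@tstep R) q w, foldl hstep u w).
Proof. by elim: w q u => //= c w IH q u; rewrite IH. Qed.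

Variables (q : R[i] * R[i] * R[i]) (u : colours).
Local Notation node := (foldl (@tstep R) q).
Hypothesis small_fin : finite_set [set w | cnorm (node w).2 <= 2].
Hypothesis q1 : ~~ (-2 <= q.1.1 <= 2).
Hypothesis q2 : ~~ (-2 <= q.1.2 <= 2).
Hypothesis q3 : forall w, ~~ (-2 <= (node w).2 <= 2).
Hypothesis qmu : markoff q = mu.
Hypothesis mu4 : mu != 4.
Hypothesis q1mu : q.1.1 ^+ 2 != mu.
Hypothesis q2mu : q.1.2 ^+ 2 != mu.
Hypothesis pc1 : pc u.1 + pc u.2 + pc (addb2 u.1 u.2) = 1.

Lemma node_z_hyperbolic w : hyperbolic (node w).2 ((node w).2 * hg (node w).2).
Proof. exact/hyperbolic_half_gap/q3. Qed.

Lemma node_goodness : exists C, forall n, tree_sum (@tstep R) (@weight R) n q <= C.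
Proof.
apply: tree_good => //.
- by exists (q.1.1 * hg q.1.1); exact: hyperbolic_half_gap.
- by exists (q.1.2 * hg q.1.2); exact: hyperbolic_half_gap.
- by move=> w; exists ((node w).2 * hg (node w).2); exact: node_z_hyperbolic.
- by rewrite qmu.
Qed.

(** z^2 - mu is the product of xz - y - l x and y - l x; either one vanishes only if the traces
    around the third curve decay in one of the two directions. *)
Lemma node_z_mu w : (node w).2 ^+ 2 != mu.
Proof.
have := node_z_hyperbolic w; set l := _ * hg _ => zl.
have := @no_decay_swap _ _ small_fin (rcons w false) l.
have := @no_decay _ _ small_fin (rcons w true) l.
have := markoff_foldl q w; rewrite qmu !foldl_rcons.
case: (node w) zl => [[x y] z] /= zl muE /(_ zl) h1 /(_ zl) h2.
rewrite -muE -subr_eq0.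
have [l0 _ zE] := zl.
have lz : l * z = l ^+ 2 + 1 by rewrite zE; field.
have -> : z ^+ 2 - (x ^+ 2 + y ^+ 2 + z ^+ 2 - x * y * z) =
    (x * z - y - l * x) * (y - l * x) + x ^+ 2 * (l * z - (l ^+ 2 + 1)) by ring.
rewrite lz subrr mulr0 addr0 mulf_neq0 ?subr_eq0 //.
apply: contraNneq h1 => ->.
have -> : z * (l * x) - x = x * (l * z - 1) by ring.
by rewrite lz; apply/eqP; ring.
Qed.

Lemma node_edge (P : R[i] -> Prop) : P q.1.1 -> P q.1.2 ->
  (forall w, P (node w).2) -> forall w, P (node w).1.1 /\ P (node w).1.2.
Proof. by case: q => [[x y] z]; exact: node_ind. Qed.

(** Beyond some level the weight is below 1/3, so |z| > 3, and |z| <= |l| + 1/|l| forces |l| <= 1/2.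
    The finitely many earlier nodes only change the constant. *)
Lemma node_bounds : exists C, [/\ 0 < C,
  forall w, weight (node w) <= C &
  forall w, (cnorm ((node w).1.1 * hg (node w).1.1) <= 1 - C^-1 /\
            cnorm ((node w).1.2 * hg (node w).1.2) <= 1 - C^-1)].
Proof.
have [C CP] := node_goodness.
have wC w : weight (node w) <= C.
  apply: le_trans (level_sum_ge _ q w (@weight_ge0 R)) _.
  apply: le_trans (CP (size w).+1); rewrite tree_sum_level big_ord_recr /= lerDr.
  apply: sumr_ge0 => j _; have l0 n p : 0 <= level_sum (@tstep R) (@weight R) n p.
    by elim: n p => [|n IH] p /=; rewrite ?weight_ge0 // addr_ge0.
  exact: l0.
pose f (x : R[i]) := (1 - cnorm (x * hg x))^-1.
have [B BP] := level_sum_to0 (@weight_ge0 R) CP (ltac:(by []) : 0 < (1 / 3 : R)).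
have [D DP] : exists D, forall w, f (node w).2 <= D.
  apply: (@bounded_words R B _ 2) => w Bw.
  have : weight (node w) < 1 / 3.
    exact: le_lt_trans (level_sum_ge _ q w (@weight_ge0 R)) (BP _ Bw).
  have := node_z_hyperbolic w; rewrite /f; case: (node w) => [[x y] z] /=.
  set l := z * hg z => -[l0 l1 zE] wz.
  have z3 : (cnorm z)^-1 < 1 / 3.
    by apply: le_lt_trans wz; rewrite -addrA lerDl addr_ge0 ?invr_ge0 ?cnorm_ge0.
  have l0' : 0 < cnorm l by rewrite cnorm_gt0.
  have zn : cnorm z <= cnorm l + (cnorm l)^-1 by rewrite {1}zE -cnormV cnormD.
  have z0 : 0 < cnorm z.
    rewrite cnorm_gt0; apply: contraNneq l0 => z0; by rewrite /l z0 mul0r.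
  have z3' : 3 < cnorm z.
    by move: z3; rewrite div1r ltf_pV2 ?posrE.
  have lh : cnorm l <= 1 / 2.
    rewrite leNgt; apply/negP => lh.
    have : (cnorm l)^-1 < 2 by rewrite invf_plt ?posrE // -div1r.
    lra.
  by rewrite invf_ple ?posrE; lra.
pose D' := Num.max D (Num.max (f q.1.1) (f q.1.2)).
pose C' := Num.max 1 (Num.max C D').
have C'0 : 0 < C' by rewrite lt_max ltr01.
have D'C : D' <= C' by rewrite /C' le_max; apply/orP; right; rewrite le_max lexx orbT.
have inv x : ~~ (-2 <= x <= 2) -> f x <= D' -> cnorm (x * hg x) <= 1 - C'^-1.
  move=> /hyperbolic_half_gap[_ l1 _] fD.
  have h : f x <= C' by exact: le_trans fD D'C.
  have fx0 : 0 < 1 - cnorm (x * hg x) by lra.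
  have : C'^-1 <= 1 - cnorm (x * hg x).
    by rewrite invf_ple ?posrE.
  by lra.
exists C'; split=> // [w|w]; first by rewrite /C' !le_max wC !orbT.
have := node_edge (P := fun x => cnorm (x * hg x) <= 1 - C'^-1); apply.
- by apply: inv => //; rewrite /D' !le_max lexx !orbT.
- by apply: inv => //; rewrite /D' !le_max lexx !orbT.
- by move=> v; apply: inv => //; rewrite /D' !le_max DP.
Qed.

Lemma node_edge_mu w : (node w).1.1 ^+ 2 != mu /\ (node w).1.2 ^+ 2 != mu.
Proof. by apply: (node_edge (P := fun x => x ^+ 2 != mu)) => //; exact: node_z_mu. Qed.

Lemma node_edge_hyperbolic w :
  hyperbolic (node w).1.1 ((node w).1.1 * hg (node w).1.1) /\
  hyperbolic (node w).1.2 ((node w).1.2 * hg (node w).1.2).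
Proof.
apply: (node_edge (P := fun x => hyperbolic x (x * hg x))).
- exact: hyperbolic_half_gap.
- exact: hyperbolic_half_gap.
- exact: node_z_hyperbolic.
Qed.

Lemma hyperbolic_neq0 x : hyperbolic x (x * hg x) -> x != 0.
Proof. by move=> [l0 _ _]; apply: contraNneq l0 => ->; rewrite mul0r. Qed.

Lemma weight_pos w : 0 < weight (node w).
Proof.
have /hyperbolic_neq0 := node_z_hyperbolic w; case: (node w) => [[x y] z] /= z0.
by rewrite -addrA ltr_pwDl ?invr_gt0 ?cnorm_gt0 // addr_ge0 ?invr_ge0 ?cnorm_ge0.
Qed.

(** Summability puts all but finitely many nodes below the threshold [e]; the others are absorbed
    into the constant because weights are positive. *)
Lemma weight_bounded (f : seq bool -> R) (e C : R) : 0 < e ->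
  (forall w, weight (node w) < e -> f w <= C * weight (node w)) ->
  exists D, forall w, f w <= D * weight (node w).
Proof.
move=> e0 fC; have [A AP] := node_goodness.
have [B BP] := level_sum_to0 (@weight_ge0 R) AP e0.
have [|D DP] := @bounded_words R B (fun w => f w / weight (node w)) C.
  move=> w Bw; rewrite ler_pdivrMr ?weight_pos //; apply: fC.
  exact: le_lt_trans (level_sum_ge _ q w (@weight_ge0 R)) (BP _ Bw).
by exists D => w; rewrite -ler_pdivrMr ?weight_pos.
Qed.

Definition pc_bound : R :=
  cnorm (pc (true, false)) + cnorm (pc (false, true)) + cnorm (pc (true, true))
  + cnorm (pc (false, false)).

Lemma pc_le c : cnorm (pc c) <= pc_bound.
Proof.
have := cnorm_ge0 (pc (true, false)); have := cnorm_ge0 (pc (false, true)).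
have := cnorm_ge0 (pc (true, true)); have := cnorm_ge0 (pc (false, false)).
by rewrite /pc_bound; case: c => [[] []]; lra.
Qed.

Lemma node_term_bound : exists D, forall w,
  cnorm (node_term (foldl cstep (q, u) w)) <= D * weight (node w).
Proof.
have m0 := cnorm_ge0 mu.
apply: (@weight_bounded _ (1 + 2 * cnorm mu)^-1 (2 + 5 * (pc_bound * cnorm mu))).
  by rewrite invr_gt0; lra.
move=> w; rewrite /node_term foldl_cstep /=; move: (colour3 _) => c wsmall.
have zl := node_z_hyperbolic w; have z0 := hyperbolic_neq0 zl.
have zw : (cnorm (node w).2)^-1 <= weight (node w).
  case: (node w) => [[x y] z] /=.
  by rewrite -addrA lerDl addr_ge0 ?invr_ge0 ?cnorm_ge0.
have big : 1 + 2 * cnorm mu <= cnorm (node w).2.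
  rewrite -lef_pV2 ?posrE ?cnorm_gt0 //; last by lra.
  by apply/ltW/(le_lt_trans zw).
apply: le_trans (h_fun_bound zl erefl big (pc_le c)) _.
rewrite ler_wpM2l // addr_ge0 // mulr_ge0 // mulr_ge0 //.
exact: le_trans (cnorm_ge0 _) (pc_le c).
Qed.

Lemma edge_term_bound : exists D, forall w,
  cnorm (edge_term (foldl cstep (q, u) w)) <= D * weight (node w).
Proof.
have [C [C0 wC lC]] := node_bounds.
have m0 := cnorm_ge0 mu.
have P0 : 0 <= pc_bound by exact: le_trans (cnorm_ge0 _) (pc_le (true, true)).
pose r := 1 - C^-1; pose d := C^-1.
have d0 : 0 < d by rewrite invr_gt0.
have r1 : r < 1 by rewrite /r -/d; lra.
pose A := (2 + cnorm mu / d) / (1 - r) + 2 + 2 * (pc_bound * cnorm mu / ((1 - r) * d)).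
(* Below the threshold 1 a node is admissible, since inadmissibility alone contributes 1 to the
   weight. *)
apply: (@weight_bounded _ 1 A) => // w wsmall.
rewrite /edge_term foldl_cstep /=.
have [lx ly] := lC w; have [hx hy] := node_edge_hyperbolic w.
have [xmu ymu] := node_edge_mu w; have z0 := hyperbolic_neq0 (node_z_hyperbolic w).
have := wC w; move: wsmall lx ly hx hy xmu ymu z0 (markoff_foldl q w); rewrite qmu.
case: (node w) => [[x y] z] /= w1 lx ly hx hy xmu ymu z0 muE wle.
have i0 : 0 <= (cnorm z)^-1 by rewrite invr_ge0 cnorm_ge0.
have j0 : 0 <= (cnorm (x * y))^-1 by rewrite invr_ge0 cnorm_ge0.
have adm : admissible (x, y, z).
  by apply/negPn/negP => /negbTE E; move: w1; rewrite /= in E; rewrite E /=; lra.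
have adm' := adm; rewrite /= in adm'; rewrite adm' /= addr0 in w1 wle *.
have zd : d <= cnorm z.
  by rewrite /d invf_ple ?posrE ?cnorm_gt0 //; lra.
apply: (@le_trans _ _ (A / cnorm (x * y))).
  exact: (edge_fun_bound hx erefl hy erefl xmu ymu lx ly r1 d0 zd (pc_le _) (pc_le _) muE adm).
have A0 : 0 <= A.
  have r0 : 0 < 1 - r by lra.
  have h1 : 0 <= (2 + cnorm mu / d) / (1 - r).
    by apply: divr_ge0; [apply: addr_ge0 => //; apply: divr_ge0 => //|]; exact: ltW.
  have h2 : 0 <= pc_bound * cnorm mu / ((1 - r) * d).
    by apply: divr_ge0; apply: mulr_ge0 => //; exact: ltW.
  by rewrite /A; lra.
by rewrite ler_wpM2l //; lra.
Qed.

Lemma hstep_sum (v : colours) c : pc v.1 + pc v.2 + pc (addb2 v.1 v.2) = 1 ->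
  pc (hstep v c).1 + pc (hstep v c).2 + pc (addb2 (hstep v c).1 (hstep v c).2) = 1.
Proof.
have K x y : addb2 x (addb2 x y) = y by case: x y => [[] []] [[] []].
have K' x y : addb2 (addb2 x y) y = x by case: x y => [[] []] [[] []].
by case: c => /= <-; rewrite ?K ?K'; ring.
Qed.

Lemma coloured_telescope n :
  tree_sum cstep node_term n (q, u) = edge_term (q, u) - level_sum cstep edge_term n (q, u).
Proof.
apply: tree_sum_telescope => w; rewrite foldl_cstep /=.
have colw : forall v, pc (foldl hstep u v).1 + pc (foldl hstep u v).2 +
    pc (addb2 (foldl hstep u v).1 (foldl hstep u v).2) = 1.
  by elim/last_ind => [|v c IH] //; rewrite foldl_rcons; exact: hstep_sum.
have [hx hy] := node_edge_hyperbolic w.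
have [xmu ymu] := node_edge_mu w; have z0 := hyperbolic_neq0 (node_z_hyperbolic w).
move: (colw w) (hyperbolic_neq0 hx) (hyperbolic_neq0 hy) xmu ymu z0 (node_z_mu w)
  (markoff_foldl q w); rewrite qmu.
have K x y : addb2 x (addb2 x y) = y by case: x y => [[] []] [[] []].
case: (node w) => [[x y] z] /= pcE x0 y0 xmu ymu z0 zmu muE.
rewrite /edge_term /node_term /colour3 /=.
exact: edge_fun_step.
Qed.

Lemma coloured_abs_bound : exists C, forall n,
  tree_sum cstep (fun s => cnorm (node_term s)) n (q, u) <= C.
Proof.
have [D DP] := node_term_bound; have [C CP] := node_goodness.
exists (Num.max 0 D * C) => n.
apply: (@le_trans _ _ (tree_sum cstep (fun s => Num.max 0 D * weight s.1) n (q, u))).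
  apply: le_tree_sum => w; apply: le_trans (DP w) _; rewrite foldl_cstep /=.
  by rewrite ler_wpM2r ?weight_ge0 // le_max lexx orbT.
rewrite tree_sumZ ler_wpM2l ?le_max ?lexx //.
by rewrite (tree_sum_map (sT := @tstep R) (k := fst)).
Qed.

Lemma coloured_level_to0 (e : R) : 0 < e -> exists B, forall n, (B <= n)%N ->
  cnorm (level_sum cstep edge_term n (q, u)) <= e.
Proof.
move=> e0; have [D DP] := edge_term_bound; have [C CP] := node_goodness.
pose D' := Num.max 1 D; have D0 : 0 < D' by rewrite lt_max ltr01.
have w0 (s : state) : 0 <= D' * weight s.1 by rewrite mulr_ge0 ?weight_ge0 // ltW.
have [|B BP] := @level_sum_to0 R state cstep (fun s => D' * weight s.1) (q, u) (D' * C) e w0 _ e0.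
  move=> n; rewrite tree_sumZ ler_pM2l //.
  by rewrite (tree_sum_map (sT := @tstep R) (k := fst)).
exists B => n /BP /ltW; apply: le_trans; apply: le_trans (cnorm_level_sum _ _ _ _) _.
apply: le_level_sum => w; apply: le_trans (DP w) _; rewrite foldl_cstep /=.
by rewrite ler_wpM2r ?weight_ge0 // le_max lexx orbT.
Qed.

End ColouredTree.

(** * Unordered sums *)

Section Exhaustion.
Variables (R : realType) (T : choiceType) (D : set T) (f : T -> R[i]).
Variables (s : nat -> seq T) (C : R).
Hypothesis s_uniq : forall n, uniq (s n).
Hypothesis s_mono : forall m n, (m <= n)%N -> {subset s m <= s n}.
Hypothesis s_exh : forall t, D t -> exists n, t \in s n.
Hypothesis s_bound : forall n, \sum_(t <- s n | t \in D) cnorm (f t) <= C.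

Lemma cnorm_sum (r : seq T) (P : pred T) :
  cnorm (\sum_(t <- r | P t) f t) <= \sum_(t <- r | P t) cnorm (f t).
Proof.
elim/big_rec2: _ => [|t y x _ xy]; first by rewrite (cnorm_nat _ 0).
by apply: le_trans (cnormD _ _) _; rewrite lerD2l.
Qed.

Lemma sum_sub_seq (V : zmodType) (g : T -> V) (r r' : seq T) : uniq r -> uniq r' ->
  {subset r <= r'} ->
  \sum_(t <- r' | t \in D) g t = \sum_(t <- r | t \in D) g t +
    \sum_(t <- r' | (t \in D) && (t \notin r)) g t.
Proof.
move=> ur ur' rr'; rewrite (bigID (mem r)) /=; congr (_ + _).
rewrite -[LHS]big_filter -[RHS]big_filter.
apply/perm_big/uniq_perm; rewrite ?filter_uniq // => t.
by rewrite !mem_filter; case: (t \in D); case tr: (t \in r) => //=; rewrite rr'.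
Qed.

Lemma exhaust_subset (r : seq T) : exists n, forall t, t \in r -> t \in D -> t \in s n.
Proof.
elim: r => [|x r [n IH]]; first by exists 0%N.
have [xD|xD] := boolP (x \in D).
  have [m xm] : exists m, x \in s m by apply: s_exh; rewrite inE in xD.
  exists (maxn m n) => t; rewrite inE => /orP[/eqP-> _|tr tD].
    exact: s_mono (leq_maxl _ _) _ xm.
  exact: s_mono (leq_maxr _ _) _ (IH _ tr tD).
exists n => t; rewrite inE => /orP[/eqP->|]; last exact: IH.
by rewrite (negPf xD).
Qed.

Let a n := \sum_(t <- s n | t \in D) cnorm (f t).
Let u n := \sum_(t <- s n | t \in D) f t.

Lemma exhaust_mono m n : (m <= n)%N -> a m <= a n.
Proof.
move=> mn; rewrite /a (sum_sub_seq _ (s_uniq m) (s_uniq n) (s_mono mn)) lerDl.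
by apply: sumr_ge0 => *; exact: cnorm_ge0.
Qed.

Lemma exhaust_le (r : seq T) : uniq r ->
  exists n, \sum_(t <- r | t \in D) cnorm (f t) <= a n.
Proof.
move=> ur; have [n rn] := exhaust_subset r; exists n; rewrite /a.
have u1 : uniq [seq t <- r | t \in D] by rewrite filter_uniq.
have sub : {subset [seq t <- r | t \in D] <= s n}.
  by move=> t; rewrite mem_filter => /andP[tD tr]; exact: rn.
rewrite (sum_sub_seq _ u1 (s_uniq n) sub) big_filter_cond.
rewrite (eq_bigl (fun t => t \in D)) => [|t]; last by rewrite andbb.
by rewrite lerDl; apply: sumr_ge0 => *; exact: cnorm_ge0.
Qed.

(* Both parts of f are differences of nonnegative summable functions. *)
Lemma exhaust_part_cvg (k : R[i] -> R) :
  (forall x y, k (x + y) = k x + k y) -> k 0 = 0 -> (forall x, `|k x| <= cnorm x) ->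
  exists l : R, (fun n => k (u n)) @ \oo --> l.
Proof.
move=> kD k0 kn.
have ksum n : k (u n) = \sum_(t <- s n | t \in D) k (f t).
  by rewrite /u; elim/big_rec2: _ => [|t y x _ <-] //; rewrite kD.
pose v n := \sum_(t <- s n | t \in D) (k (f t) + cnorm (f t)).
have kv n : k (u n) = v n - a n by rewrite ksum /v big_split /= addrK.
have a_cvg : cvgn a.
  apply: nondecreasing_is_cvgn; first by move=> m n; exact: exhaust_mono.
  by exists C => _ [n _ <-]; exact: s_bound.
have v_cvg : cvgn v.
  apply: nondecreasing_is_cvgn.
    move=> m n mn; rewrite /v (sum_sub_seq _ (s_uniq m) (s_uniq n) (s_mono mn)) lerDl.
    apply: sumr_ge0 => t _; have := kn (f t); rewrite ler_norml; lra.
  exists (C + C) => _ [n _ <-]; rewrite /v big_split /=; apply: lerD; last exact: s_bound.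
  apply: le_trans (s_bound n); apply: ler_sum => t _.
  by apply: le_trans (kn _); exact: ler_norm.
exists (limn v - limn a); rewrite (_ : (fun n => k (u n)) = v \- a).
  exact: cvgB.
by apply/funext => n; rewrite kv.
Qed.

Lemma cnorm_le_parts (x : R[i]) : cnorm x <= `|complex.Re x| + `|complex.Im x|.
Proof.
case: x => p q; rewrite /cnorm /= -[leRHS]ger0_norm ?addr_ge0 // -sqrtr_sqr.
rewrite ler_wsqrtr // sqrrD !real_normK ?num_real // [leRHS]addrAC lerDl.
by rewrite mulrn_wge0 // mulr_ge0.
Qed.

Lemma exhaust_limit : exists S, forall e : R, 0 < e ->
  exists n0, forall n, (n0 <= n)%N -> cnorm (u n - S) <= e.
Proof.
have [||x|l1 L1] := @exhaust_part_cvg (fun x => complex.Re x).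
- by move=> [? ?] [? ?].
- by [].
- by case: x => p q; rewrite /cnorm /= -sqrtr_sqr ler_wsqrtr // lerDl sqr_ge0.
have [||x|l2 L2] := @exhaust_part_cvg (fun x => complex.Im x).
- by move=> [? ?] [? ?].
- by [].
- by case: x => p q; rewrite /cnorm /= -sqrtr_sqr ler_wsqrtr // lerDr sqr_ge0.
exists (l1 +i* l2) => e e0.
have e2 : 0 < e / 2 by rewrite divr_gt0.
have [n1 _ H1] := (cvgrPdist_le _ _).1 L1 _ e2.
have [n2 _ H2] := (cvgrPdist_le _ _).1 L2 _ e2.
exists (maxn n1 n2) => n; rewrite geq_max => /andP[/H1 + /H2].
move=> h1 h2; have := cnorm_le_parts (u n - (l1 +i* l2)).
move: (u n) h1 h2 => [p q] h1 h2 h3; apply: le_trans h3 _; rewrite /= in h1 h2 *.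
by rewrite (distrC p) (distrC q); lra.
Qed.

(** The absolute sums [a n] come close to their supremum, so whatever a finite set adds to [s n] is
    small in absolute sum; this turns convergence along the exhaustion into convergence over finite
    subsets. *)
Lemma has_abs_sum_exhaustion : exists S, has_abs_sum D f S /\
  forall e : R, 0 < e -> exists n0, forall n, (n0 <= n)%N -> cnorm (u n - S) <= e.
Proof.
have [S SP] := exhaust_limit; exists S; split=> //; split.
  rewrite /summable.
  apply: (@le_lt_trans _ _ C%:E); last exact: ltry.
  apply: ge_ereal_sup => _ [A [finA AD] <-].
  rewrite fsbig_finite //=.
  have -> : (\sum_(i <- fset_set A) `|(ComplexField.Normc.normc (f i))%:E|)%E =
      (\sum_(i <- fset_set A) cnorm (f i))%:E.
    rewrite -sumEFin; apply: eq_bigr => t _.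
    by rewrite abse_EFin ger0_norm //; exact: cnorm_ge0.
  rewrite lee_fin; have [n le_n] := exhaust_le (fset_uniq (fset_set A)).
  apply: le_trans (s_bound n); apply: le_trans le_n.
  rewrite [leRHS]big_seq_cond [leLHS]big_seq_cond le_eqVlt; apply/orP; left; apply/eqP.
  apply: eq_bigl => t; rewrite andbT; case tA: (t \in _) => //=; apply/esym/mem_set/AD.
  by move: tA; rewrite in_fset_set // => /set_mem.
have [asup [aub alim]] : exists A, (forall n, a n <= A) /\
    forall e : R, 0 < e -> exists n, A - e <= a n.
  have a_cvg : cvgn a.
    apply: nondecreasing_is_cvgn; first by move=> m n; exact: exhaust_mono.
    by exists C => _ [n _ <-]; exact: s_bound.
  exists (limn a); split=> [n|e e0].
    by apply: nondecreasing_cvgn_le => // m k; exact: exhaust_mono.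
  have [n0 _ H] := (cvgrPdist_le _ _).1 a_cvg _ e0; exists n0.
  by have := H n0 (leqnn n0); rewrite /= ler_norml; lra.
have FF : ProperFilter (@summability.totally T) := summability.totally_filter.
apply/cvgrPdist_le => e e0.
have [e1 e1E] : exists e1 : R, e = e1%:C.
  by exists (complex.Re e); case: e e0 => p q; rewrite ltcE /= => /andP[/eqP ->].
rewrite e1E ltcR in e0 *.
have e3 : 0 < e1 / 2 by rewrite divr_gt0.
have [n1 H1] := SP _ e3; have [n2 H2] := alim _ e3.
pose n := maxn n1 n2.
exists [fset t in s n]%fset => // B /= nB.
rewrite cnormE lecR.
have sB : {subset s n <= (B : seq T)}.
  by move=> t tn; move/fsubsetP: nB => /(_ t); rewrite !inE; exact.
rewrite (sum_sub_seq _ (s_uniq n) (fset_uniq B) sB) -/(u n) opprD addrA.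
apply: le_trans (cnormB _ _) _.
have h1 : cnorm (S - u n) <= e1 / 2.
  by rewrite -cnormN opprB; apply: H1; exact: leq_maxl.
have h2 := cnorm_sum B (fun t => (t \in D) && (t \notin s n)).
have [m hm] := exhaust_le (fset_uniq B).
have := sum_sub_seq (fun t => cnorm (f t)) (s_uniq n) (fset_uniq B) sB.
rewrite -/(a n) => h3; have := aub m; have := exhaust_mono (leq_maxr n1 n2); rewrite -/n.
lra.
Qed.

End Exhaustion.

(** * The identity *)

Fixpoint words (n : nat) : seq (seq bool) :=
  if n is n'.+1 then
    [::] :: map (cons false) (words n') ++ map (cons true) (words n')
  else [::].

Lemma mem_words n w : (w \in words n) = (size w < n)%N.
Proof.
elim: n w => [|n IH] w //=; rewrite inE mem_cat.
have cons_inj (b : bool) : injective (cons b) by move=> ? ? [].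
case: w => [|[] w] //=; rewrite ltnS -IH.
  rewrite (mem_map (cons_inj true)) (_ : _ \in _ = false) //.
  by apply/negbTE/mapP => -[].
rewrite (mem_map (cons_inj false)) (_ : _ \in map (cons true) _ = false) ?orbF //.
by apply/negbTE/mapP => -[].
Qed.

Lemma words_uniq n : uniq (words n).
Proof.
elim: n => [|n IH] //=; rewrite cat_uniq !map_inj_uniq ?IH /=; try by move=> ? ? [].
rewrite andbT mem_cat negb_or -andbA; apply/and3P; split.
- by apply/mapP => -[].
- by apply/mapP => -[].
- by apply/hasPn => _ /mapP[w _ ->]; apply/mapP => -[].
Qed.

Lemma sum_words (S : Type) (step : S -> bool -> S) (V : zmodType) (g : S -> V) n q :
  \sum_(w <- words n) g (foldl step q w) = tree_sum step g n q.
Proof.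
elim: n q => [|n IH] q /=; first by rewrite big_nil.
by rewrite big_cons big_cat !big_map /= !IH.
Qed.

Definition curve_indices (n : nat) : seq (bool + bool * seq bool) :=
  [:: inl false, inl true & [seq inr (false, w) | w <- words n] ++
                           [seq inr (true, w) | w <- words n]].

Lemma sum_curve_indices (V : zmodType) (g : bool + bool * seq bool -> V) n :
  \sum_(i <- curve_indices n) g i = g (inl false) + (g (inl true) +
    (\sum_(w <- words n) g (inr (false, w)) + \sum_(w <- words n) g (inr (true, w)))).
Proof. by rewrite !big_cons big_cat !big_map. Qed.

Lemma curve_indices_uniq n : uniq (curve_indices n).
Proof.
have injr (e : bool) : injective (fun w : seq bool => inr (e, w) : bool + bool * seq bool).
  by move=> ? ? [].
rewrite /curve_indices /= !inE !mem_cat cat_uniq !map_inj_uniq ?words_uniq // andbT.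
apply/and3P; split.
- by rewrite negb_or; apply/andP; split=> //; rewrite negb_or; apply/andP; split;
    apply/mapP => -[].
- by rewrite negb_or; apply/andP; split; apply/mapP => -[].
- by apply/hasPn => _ /mapP[w _ ->]; apply/mapP => -[].
Qed.

Lemma curve_indices_mono m n : (m <= n)%N -> {subset curve_indices m <= curve_indices n}.
Proof.
move=> mn i; rewrite !inE !mem_cat => /or4P[->|->|/mapP[w wm ->]|/mapP[w wm ->]];
  rewrite ?orbT //.
  by apply/or4P; constructor 3; apply: map_f; move: wm; rewrite !mem_words => /leq_trans; apply.
by apply/or4P; constructor 4; apply: map_f; move: wm; rewrite !mem_words => /leq_trans; apply.
Qed.

Lemma curve_indices_exh i : exists n, i \in curve_indices n.
Proof.
case: i => [[]|[e w]]; first by exists 0%N.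
  by exists 0%N.
have H : w \in words (size w).+1 by rewrite mem_words.
exists (size w).+1; move: (size w).+1 H => n wn; rewrite !inE mem_cat.
by case: e; apply/or4P; [constructor 4|constructor 3]; apply/mapP; exists w.
Qed.

Lemma colour_neq0 i : colour i != (false, false).
Proof.
case: i => [[]|[e w]] //=.
have : [&& (foldl hstep hroot w).1 != (false, false),
    (foldl hstep hroot w).2 != (false, false) &
    (foldl hstep hroot w).1 != (foldl hstep hroot w).2].
  elim/last_ind: w => [|w c IH] //; rewrite foldl_rcons.
  by move: (foldl _ _ _) IH => [[[] []] [[] []]]; case: c.
by move: (foldl _ _ _) => [[[] []] [[] []]].
Qed.

Theorem theorem1p3 (R : realType) (pi1 : groupType) (a b : pi1)
    (hab : free_basis a b)
    (rho : pi1 -> 'M[R[i]]_2)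
    (rho_rep : SL2_representation rho)
    (rho_irr : irreducible_representation rho)
    (p1 p2 p3 : R[i]) (hp : p1 + p2 + p3 = 1)
    (hB : Bowditch_conditions rho) :
  let mu := peripheral_trace a b rho + 2 in
  exists S1 S2 S3 : R[i],
    [/\ has_abs_sum (Omega1 a b) (fun X => h_fun mu p1 (curve_trace rho X)) S1,
        has_abs_sum (Omega2 a b) (fun X => h_fun mu p2 (curve_trace rho X)) S2,
        has_abs_sum (Omega3 a b) (fun X => h_fun mu p3 (curve_trace rho X)) S3
      & S1 + S2 + S3 = 1 / 2].
Proof.
move=> mu; have [trI small] := hB.
pose tr i := \tr (rho (curve_rep a b i)).
have trE i : curve_trace rho (curve a b i) = tr i by exact: curve_traceE.
have trN i : ~~ (-2 <= tr i <= 2) by rewrite -trE; apply/trI/Omega_curve.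
pose q e := trace_triple rho (groot a b e).
have nodeE e w : tr (inr (e, w)) = (foldl (@tstep R) (q e) w).2.
  by rewrite -trace_triple_node.
have nodeN e w : ~~ (-2 <= (foldl (@tstep R) (q e) w).2 <= 2) by rewrite -nodeE.
have small_fin e : finite_set [set w | cnorm (foldl (@tstep R) (q e) w).2 <= 2].
  pose c w := curve a b (inr (e, w)).
  apply: (@sub_finite_set _ _ (c @^-1` [set X | Omega X /\ `|curve_trace rho X| <= 2])).
    move=> w /= zw; split; first exact: Omega_curve.
    by rewrite trE nodeE cnormE -(rmorph_nat (real_complex R)) lecR.
  apply: finite_preimage => // w v _ _ /(curve_inj hab) []; exact.
pose x := tr (inl false); pose y := tr (inl true); pose z := (q false).2.
have q0 : q false = (x, y, z) by [].
(* The trace of a^-1 b is xy - z: the two sides of the root edge carry the two roots of the Markoff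
   equation in its third variable. *)
have q1 : q true = (x, y, x * y - z).
  rewrite /q /trace_triple /= trace_repV //; congr (_, _, _).
  by rewrite (rho_rep.1) (repV rho_rep) trace_adj2_mul /x /y /z /tr /= -(rho_rep.1).
have mu0 : markoff (q false) = mu by rewrite /q (markoff_trace_triple rho_rep).
have mu1 : markoff (q true) = mu by rewrite q1 -mu0 q0 /markoff; ring.
have hx := hyperbolic_half_gap (trN (inl false)).
have hy := hyperbolic_half_gap (trN (inl true)).
rewrite -/x in hx; rewrite -/y in hy.
have mu4 : mu != 4.
  rewrite -mu0; apply: (irreducible_markoff rho_rep hab rho_irr).
    exact: det_sub_scalar (rho_rep.2 a) hx.
  exact: det_sub_scalar (rho_rep.2 b) hy.
have muE : mu = x ^+ 2 + y ^+ 2 + z ^+ 2 - x * y * z by rewrite -mu0 q0.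
(* The factorization of [node_z_mu] for a curve of the root edge: its neighbours continue from [z]
   on one side and from [u * v - z] on the other. *)
have prodE u v l : hyperbolic u l -> u ^+ 2 + v ^+ 2 + z ^+ 2 - u * v * z = mu ->
    z != l * v -> u * v - z != l * v -> u ^+ 2 != mu.
  move=> [l0 _ uE] muE' h1 h2; rewrite -muE' -subr_eq0.
  have lu : l * u = l ^+ 2 + 1 by rewrite uE; field.
  have -> : u ^+ 2 - (u ^+ 2 + v ^+ 2 + z ^+ 2 - u * v * z) =
      (z - l * v) * (u * v - z - l * v) + v ^+ 2 * (l * u - (l ^+ 2 + 1)) by ring.
  by rewrite lu subrr mulr0 addr0 mulf_neq0 // subr_eq0.
have xmu : x ^+ 2 != mu.
  apply: (prodE x y _ hx) => //.
    by exact: (@no_decay R (q false) (small_fin false) [::]).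
  by have := @no_decay R (q true) (small_fin true) [::]; rewrite [foldl _ _ _]/= q1; exact.
have ymu : y ^+ 2 != mu.
  apply: (prodE y x _ hy); first by rewrite muE; ring.
    by exact: (@no_decay_swap R (q false) (small_fin false) [::]).
  have := @no_decay_swap R (q true) (small_fin true) [::].
  rewrite [foldl _ _ _]/= q1 (mulrC y x); exact.
(* The last branch serves the colour (true, true); no curve has colour (false, false). *)
pose pc (c : bool * bool) := if c == (true, false) then p1
  else if c == (false, true) then p2 else p3.
pose g i := h_fun mu (pc (colour i)) (tr i).
have q_xy e : (q e).1.1 = x /\ (q e).1.2 = y by case: e; rewrite ?q0 ?q1.
have qN1 e : ~~ (-2 <= (q e).1.1 <= 2) by rewrite (q_xy e).1; exact: trN.
have qN2 e : ~~ (-2 <= (q e).1.2 <= 2) by rewrite (q_xy e).2; exact: trN.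
have qmu e : markoff (q e) = mu by case: e.
have qmu1 e : (q e).1.1 ^+ 2 != mu by rewrite (q_xy e).1.
have qmu2 e : (q e).1.2 ^+ 2 != mu by rewrite (q_xy e).2.
have pc1 : pc hroot.1 + pc hroot.2 + pc (addb2 hroot.1 hroot.2) = 1 by [].
have gE e w : g (inr (e, w)) = node_term mu pc (foldl (@cstep R) (q e, hroot) w).
  by rewrite /g /node_term foldl_cstep nodeE.
have absE e := coloured_abs_bound pc hroot (small_fin e) (qN1 e) (qN2 e) (nodeN e) (qmu e) mu4.
have [C CP] : exists C, forall n, \sum_(i <- curve_indices n) cnorm (g i) <= C.
  have [C0 C0P] := absE false; have [C1 C1P] := absE true.
  exists (cnorm (g (inl false)) + (cnorm (g (inl true)) + (C0 + C1))) => n.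
  rewrite sum_curve_indices !lerD //.
    by under eq_bigr do rewrite gE; rewrite (sum_words (@cstep R) (fun s => cnorm (node_term mu pc s))).
  by under eq_bigr do rewrite gE; rewrite (sum_words (@cstep R) (fun s => cnorm (node_term mu pc s))).
(* By telescoping, the sum over a ball is the left side of [edge_fun_root] minus the level sums of
   the two sides, each at most e/2 in modulus. *)
have total (e : R) : 0 < e -> exists n0, forall n, (n0 <= n)%N ->
    cnorm (\sum_(i <- curve_indices n) g i - 1 / 2) <= e.
  move=> e0; have e2 : 0 < e / 2 by rewrite divr_gt0.
  have lev d := coloured_level_to0 pc hroot (small_fin d) (qN1 d) (qN2 d) (nodeN d) (qmu d) mu4
    (qmu1 d) (qmu2 d) e2.
  have [n1 H1] := lev false; have [n2 H2] := lev true.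
  exists (maxn n1 n2) => n; rewrite geq_max => /andP[/H1 h1 /H2 h2].
  rewrite sum_curve_indices.
  under eq_bigr do rewrite gE; rewrite (sum_words (@cstep R) (node_term mu pc)).
  under eq_bigr do rewrite gE; rewrite (sum_words (@cstep R) (node_term mu pc)).
  have tel d := coloured_telescope (small_fin d) (qN1 d) (qN2 d) (nodeN d) (qmu d)
    (qmu1 d) (qmu2 d) pc1 n.
  rewrite !tel.
  have := edge_fun_root z p1 p2 (hyperbolic_neq0 hx) (hyperbolic_neq0 hy) xmu ymu.
  move=> rootE.
  have -> : edge_term mu pc (q false, hroot) = edge_fun mu x y z p1 p2 by rewrite q0.
  have -> : edge_term mu pc (q true, hroot) = edge_fun mu x y (x * y - z) p1 p2.
    by rewrite q1.
  have -> : g (inl false) = h_fun mu p1 x by [].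
  have -> : g (inl true) = h_fun mu p2 y by [].
  move: (level_sum _ _ n (q false, hroot)) (level_sum _ _ n (q true, hroot)) h1 h2.
  move=> L0 L1 h1 h2; rewrite -rootE.
  move: (h_fun mu p1 x) (h_fun mu p2 y) (edge_fun mu x y z p1 p2)
    (edge_fun mu x y (x * y - z) p1 p2).
  move=> A B E F; have -> : A + (B + (E - L0 + (F - L1))) - (A + B + E + F) = - (L0 + L1).
    by ring.
  by rewrite cnormN; apply: le_trans (cnormD _ _) _; lra.
pose s n := [seq curve a b i | i <- curve_indices n].
have s_uniq n : uniq (s n).
  by rewrite map_inj_uniq ?curve_indices_uniq //; exact: curve_inj.
have s_mono m n : (m <= n)%N -> {subset s m <= s n}.
  by move=> mn _ /mapP[i im ->]; apply/map_f/(curve_indices_mono mn).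
(* One exhaustion by balls serves all three colour classes, so their limits can be compared with
   that of the whole sum. *)
have part (D : set (set pi1)) p c : (forall X, D X -> Omega X) ->
    (forall i, D (curve a b i) <-> colour i = c) -> pc c = p ->
    exists S, has_abs_sum D (fun X => h_fun mu p (curve_trace rho X)) S /\
    forall e : R, 0 < e -> exists n0, forall n, (n0 <= n)%N ->
      cnorm (\sum_(i <- curve_indices n | colour i == c) g i - S) <= e.
  move=> DO Dc pcE.
  have Dcb i : (curve a b i \in D) = (colour i == c).
    by apply/idP/eqP => [/set_mem/Dc|/Dc/mem_set].
  have fE i : colour i == c -> h_fun mu p (curve_trace rho (curve a b i)) = g i.
    by move=> /eqP ci; rewrite trE /g ci pcE.
  have [t Dt|n|S [HS SP]] := @has_abs_sum_exhaustion R _ D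
      (fun X => h_fun mu p (curve_trace rho X)) s C s_uniq s_mono.
  - have [j ->] := curve_Omega hab (DO _ Dt); have [n jn] := curve_indices_exh j.
    by exists n; exact: map_f.
  - apply: le_trans (CP n); rewrite big_map (eq_bigl _ _ Dcb).
    rewrite (eq_bigr (fun i => cnorm (g i))) => [|j /fE -> //].
    rewrite [leRHS](bigID (fun i => colour i == c)) /= lerDl.
    by apply: sumr_ge0 => *; exact: cnorm_ge0.
  exists S; split=> // e /SP[n0 H]; exists n0 => n /H.
  by rewrite big_map (eq_bigl _ _ Dcb) (eq_bigr _ fE).
have [||//|S1 [HS1 L1]] := part (Omega1 a b) p1 (true, false).
- by move=> X [].
- by move=> j; exact: Omega1_curve.
have [||//|S2 [HS2 L2]] := part (Omega2 a b) p2 (false, true).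
- by move=> X [].
- by move=> j; exact: Omega2_curve.
have [||//|S3 [HS3 L3]] := part (Omega3 a b) p3 (true, true).
- by move=> X [].
- by move=> j; exact: Omega3_curve.
exists S1, S2, S3; split=> //.
apply/eqP; rewrite -subr_eq0 -cnorm_eq0; apply/negPn/negP => ne0.
have pos : 0 < cnorm (S1 + S2 + S3 - 1 / 2) by rewrite lt_def ne0 cnorm_ge0.
(* Four approximations enter, three by colour and one for the total; errors of d/5 each add up to
   less than d. *)
set d := cnorm _ in pos; have d5 : 0 < d / 5 by rewrite divr_gt0.
have [n1 H1] := L1 _ d5; have [n2 H2] := L2 _ d5; have [n3 H3] := L3 _ d5.
have [n4 H4] := total _ d5.
pose n := (n1 + n2 + n3 + n4)%N.
have {}H1 := H1 n ltac:(rewrite /n; lia); have {}H2 := H2 n ltac:(rewrite /n; lia).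
have {}H3 := H3 n ltac:(rewrite /n; lia); have {}H4 := H4 n ltac:(rewrite /n; lia).
have split3 : \sum_(i <- curve_indices n) g i =
    \sum_(i <- curve_indices n | colour i == (true, false)) g i +
    \sum_(i <- curve_indices n | colour i == (false, true)) g i +
    \sum_(i <- curve_indices n | colour i == (true, true)) g i.
  rewrite (bigID (fun i => colour i == (true, false))) /= -addrA; congr (_ + _).
  rewrite (bigID (fun i => colour i == (false, true))) /=; congr (_ + _);
    apply: eq_bigl => i; have := colour_neq0 i; by case: (colour i) => [[] []].
rewrite split3 in H4; move: H1 H2 H3 H4.
move: (\sum_(i <- _ | _) _) (\sum_(i <- _ | _) _) (\sum_(i <- _ | _) _) => u3 u2 u1.
move=> H1 H2 H3 H4.
have dE : d <= cnorm (u1 - S1) + cnorm (u2 - S2) + cnorm (u3 - S3)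
    + cnorm (u1 + u2 + u3 - 1 / 2).
  have -> : d = cnorm ((u1 + u2 + u3 - 1 / 2) - ((u1 - S1) + (u2 - S2) + (u3 - S3))).
    by rewrite /d; congr cnorm; ring.
  have := cnormB (u1 + u2 + u3 - 1 / 2) ((u1 - S1) + (u2 - S2) + (u3 - S3)).
  have := cnormD ((u1 - S1) + (u2 - S2)) (u3 - S3).
  by have := cnormD (u1 - S1) (u2 - S2); lra.
by move: pos H1 H2 H3 H4 dE; clear; lra.
Qed.
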